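(* Let $a$ and $c$ be rational numbers and let $q=e^{2\pi i\tau}$ with $\mathrm{Im}\,\tau>0$. Then the following six identities hold (the sums run over all nonnegative integers $i,j,k$): $$\sum_{i,j,k\geq 0} \frac{q^{2i^2+2j^2+2k^2-2ik-2jk-2j+ak}}{(q^4;q^4)_i(q^4;q^4)_j(q^4;q^4)_k}=(-1,-q^a;q^2)_\infty,$$ $$\sum_{i,j,k\geq 0} \frac{q^{2i^2+2j^2+2k^2-2ik-2jk+i-j+2k}}{(q^4;q^4)_i(q^4;q^4)_j(q^4;q^4)_k}=\frac{J_2^2J_6^2}{J_1J_3J_4^2},$$ $$\sum_{i,j,k\geq 0} \frac{q^{2i^2+2j^2+2k^2-2ik-2jk-ci+cj}}{(q^4;q^4)_i(q^4;q^4)_j(q^4;q^4)_k}=\frac{\overline{J}_{2+c,4}\overline{J}_{6+c,12}}{J_4^2}+q^2\frac{\overline{J}_{-c,4}\overline{J}_{c,12}}{J_4^2},$$ $$\sum_{i,j,k\geq 0} \frac{q^{i^2+j^2+k^2-ik-jk-k}}{(q^2;q^2)_i(q^2;q^2)_j(q^2;q^2)_k}=6\frac{J_3^3}{J_1J_2^2},$$ $$\sum_{i,j,k\geq 0} \frac{q^{i^2+j^2+k^2-ik-jk+i+j-k}}{(q^2;q^2)_i(q^2;q^2)_j(q^2;q^2)_k}=2\frac{J_3^3}{J_1J_2^2},$$ $$\sum_{i,j,k\geq 0} \frac{q^{i^2+j^2+k^2-ik-jk+i+j}}{(q^2;q^2)_i(q^2;q^2)_j(q^2;q^2)_k}=\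frac{J_3^3}{J_1J_2^2}.$$
   Context: Notation: for $n\in\{0,1,2,\dots\}\cup\{\infty\}$, $(x;q)_n:=\prod_{k=0}^{n-1}(1-xq^k)$ and $(x_1,\dots,x_r;q)_n:=(x_1;q)_n\cdots(x_r;q)_n$. For rational $r$, $q^r$ means $e^{2\pi i r\tau}$. Further, $J_m:=(q^m;q^m)_\infty$ and, for rational $b$, $\overline{J}_{b,m}:=(-q^b,-q^{m-b},q^m;q^m)_\infty$. *)

(* Defs.v *)
From HB Require Import structures.
From mathcomp Require Import all_boot all_order all_algebra.
From mathcomp Require Import finmap complex.
From mathcomp Require Import all_classical all_reals all_analysis.
Set Implicit Arguments.
Unset Strict Implicit.
Unset Printing Implicit Defensive.
Import Order.TTheory GRing.Theory Num.Theory.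
Import numFieldNormedType.Exports.
Local Open Scope classical_set_scope.
Local Open Scope ring_scope.
Local Open Scope complex_scope.

(* Topological notions are taken on [R[i]^o]: the type [R[i]] itself carries no
   topology in the library, whereas the regular module of any numFieldType is
   normed by its absolute value. *)

(* The filter of "all large enough finite subsets of I". *)
Definition fset_filter (I : choiceType) : set_system {fset I} :=
  filter_from [set: {fset I}] (fun A => [set B | fsubset A B]).
Arguments fset_filter I : clear implicits.

#[global] Instance fset_filter_proper (I : choiceType) : ProperFilter (fset_filter I).
Proof.
apply: filter_from_proper; last by move=> A _; exists A; exact: fsubset_refl.
apply: filter_from_filter; first by exists fset0.
move=> A B _ _; exists (fsetU A B) => // C /= ABC; split.
  exact: fsubset_trans (fsubsetUl A B) ABC.
exact: fsubset_trans (fsubsetUr A B) ABC.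
Qed.

(* The family f is unconditionally (equivalently, absolutely) summable,
   with sum l. *)
Definition has_sum (R : realType) (I : choiceType) (f : I -> R[i]) (l : R[i])
  : Prop :=
  (fun A : {fset I} => (\sum_(x <- A) f x : R[i]^o)) @ fset_filter I
    --> (l : R[i]^o).

Definition has_sum3 (R : realType) (f : nat -> nat -> nat -> R[i]) (l : R[i])
  : Prop :=
  has_sum (fun t : nat * nat * nat => f t.1.1 t.1.2 t.2) l.

Definition cexp (R : realType) (z : R[i]) : R[i] :=
  (expR (complex.Re z) * cos (complex.Im z))
    +i* (expR (complex.Re z) * sin (complex.Im z)).

(* q^r with q = e^(2 pi i tau) *)
Definition qpow (R : realType) (tau : R[i]) (r : rat) : R[i] :=
  cexp (2 * (pi : R)%:C * 'i * ratr r * tau).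

(* (x; p)_n *)
Definition qpoch (R : realType) (x p : R[i]) (n : nat) : R[i] :=
  \prod_(0 <= k < n) (1 - x * p ^+ k).

(* (x; p)_oo *)
Definition qpoch_inf (R : realType) (x p : R[i]) : R[i] :=
  lim ((fun n : nat => (qpoch x p n : R[i]^o)) @ \oo).

(* (x_1, ..., x_r; p)_oo *)
Definition qpochs_inf (R : realType) (xs : seq R[i]) (p : R[i]) : R[i] :=
  \prod_(x <- xs) qpoch_inf x p.

Definition J (R : realType) (tau : R[i]) (m : nat) : R[i] :=
  qpoch_inf (qpow tau m%:R) (qpow tau m%:R).

Definition Jbar (R : realType) (tau : R[i]) (b : rat) (m : nat) : R[i] :=
  qpochs_inf [:: - qpow tau b; - qpow tau (m%:R - b); qpow tau m%:R]
    (qpow tau m%:R).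

(* Main.v *)
Require Import Defs.
From HB Require Import structures.
From mathcomp Require Import all_boot all_order all_algebra.
From mathcomp Require Import finmap complex.
From mathcomp Require Import all_classical all_reals all_analysis.
From mathcomp Require Import zify ring lra.
Import Order.TTheory GRing.Theory Num.Theory.
Import numFieldNormedType.Exports.
Import ComplexField.Normc.
Set Implicit Arguments.
Unset Strict Implicit.
Unset Printing Implicit Defensive.
Local Open Scope ring_scope.
Local Open Scope complex_scope.

(** Put Q = q^(2h), with h = 2 in the first three identities and h = 1 in the
    last three.  Every left-hand side is then the sum over i, j, k >= 0 of
    [q^(h(i^2 + j^2 + k^2 - ik - jk) + ai + bj + gk)
       / ((Q;Q)_i (Q;Q)_j (Q;Q)_k)]
    for suitable linear coefficients a, b, g.

    In the first identity the sums over i and j are Euler's expansions of two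
    infinite products in base Q, which interlace into the single product
    (-q^(-hk); q^h)_oo.  Its first k factors cancel against half of (Q;Q)_k,
    and what is left is a third Euler expansion, in base q^h, over k
    ([sum_product]).

    The other sums are first studied for a = -c, b = c, where the terms can be
    grouped by N = j - i.  For fixed N and k the sum over the smaller of i, j is
    a Durfee rectangle sum.  Such a sum equals 1/(Q;Q)_oo when k = 0
    ([durfee_const], [qpoch_inf_durfee]), and in general 1/(Q;Q)_oo times a
    q-binomial sum ([durfee_below]).  A Cauchy product and Euler's expansion
    then evaluate the coefficient of N as an infinite product
    ([diff_coef_nat]), which for g = 0, h, -h is a theta series in a second
    integer n by Jacobi's triple product.  So (Q;Q)_oo^2 times the triple sum
    is a combination of the lattice sums [hexsum], over (N, n) in Z^2, of
    q^(h(N^2 + Nn + n^2) + aN + bn).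

    The third identity follows by splitting according to the parity of n
    ([hexsum_parity]).  In the second one the coefficient of N carries a
    denominator 1 + q^(hN), which disappears when the terms of N and -N are
    added ([sum_thetaP]); the remaining lattice sum factors because an Eisenstein
    integer of odd norm can be multiplied by a unit so as to lie in Z[sqrt(-3)]
    ([hexsum_psi]).

    The last three identities reduce to the cubic theta function
    c(q) = sum q^(N^2 + Nn + n^2 + N) and its product J_1 c(q) = 3 J_3^3
    ([hexsum_cubic]).  The sum c(q) is three times the sum over one residue
    class of N - n modulo 3, because the rotation of order 3 that preserves the
    exponent permutes the classes ([hexsum_mod3]); and that part is the constant
    term of a product of three theta functions of base q^3 whose arguments
    interlace to a theta function of base q ([cubic_product]).  In the fifth and
    sixth identities a = b, so there the differences N = j - i are reached
    through q-difference relations in i ([sum_contiguous],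
    [weighted_contiguous]); the weighted one brings in c(q) with the weight N,
    whose average is -2/3 by the same rotation ([hexsum_center]). *)

(** * Unconditional sums of complex families *)

Arguments normc {R} x : simpl never.

Section Sums.
Variable R : realType.
Local Notation C := R[i].

Lemma normc_ge0 (z : C) : 0 <= normc z.
Proof. by case: z => a b; exact: sqrtr_ge0. Qed.

Lemma normr_normc (z : C) : `|z| = (normc z)%:C.
Proof. by case: z. Qed.

Lemma normcD (x y : C) : normc (x + y) <= normc x + normc y.
Proof. exact: le_normcD. Qed.

Lemma normcB (x y : C) : normc (x - y) = normc (y - x).
Proof. by rewrite -normcN opprB. Qed.

Lemma normcX (z : C) n : normc (z ^+ n) = normc z ^+ n.
Proof. by elim: n => [|n IH]; rewrite ?normc1 // !exprS normcM IH. Qed.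

Lemma normc_real (x : R) : normc x%:C = `|x|.
Proof. by rewrite /normc /= expr0n /= addr0 sqrtr_sqr. Qed.

Lemma normc_sum (I : Type) (s : seq I) (f : I -> C) :
  normc (\sum_(x <- s) f x) <= \sum_(x <- s) normc (f x).
Proof.
elim: s => [|x s IH]; first by rewrite !big_nil normc0.
by rewrite !big_cons; apply: le_trans (normcD _ _) _; rewrite lerD2l.
Qed.

Lemma normc_le_dist (x y : C) : normc x - normc y <= normc (x - y).
Proof. by rewrite lerBlDr; rewrite -{1}(subrK y x) normcD. Qed.

Lemma normc_eq0 (x : C) : (normc x == 0) = (x == 0).
Proof. by apply/eqP/eqP => [/eq0_normc //|->]; rewrite normc0. Qed.

Lemma normc_lt_eps_eq0 (x : C) : (forall e : R, 0 < e -> normc x < e) -> x = 0.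
Proof.
move=> H; apply: eq0_normc; apply/eqP; rewrite eq_le normc_ge0 andbT.
by rewrite leNgt; apply/negP => /H; rewrite ltxx.
Qed.

(** Restates unconditional convergence with real bounds, so that ordered-field
    reasoning applies. *)
Lemma has_sumP (I : choiceType) (f : I -> C) (l : C) :
  has_sum f l <-> forall e : R, 0 < e -> exists A : {fset I},
    forall B : {fset I}, (A `<=` B)%fset ->
      normc (\sum_(x <- B) f x - l) < e.
Proof.
rewrite /has_sum; split => [/cvgrPdist_lt H e e0|H].
  have e0' : (0 : C) < e%:C by rewrite ltcR.
  have [A _ HA] := H _ e0'; exists A => B AB.
  by move: (HA B AB) => /=; rewrite normr_normc ltcR normcB.
apply/cvgrPdist_lt => e; rewrite ltcE /= => /andP[/eqP e0 e1].
have [A HA] := H _ e1; exists A => // B /= AB.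
by rewrite normr_normc ltcE /= e0 eqxx /= normcB HA.
Qed.

Lemma has_sum_unique (I : choiceType) (f : I -> C) (l m : C) :
  has_sum f l -> has_sum f m -> l = m.
Proof.
move=> /has_sumP Hl /has_sumP Hm; apply/eqP; rewrite -subr_eq0; apply/eqP.
apply: normc_lt_eps_eq0 => e e0.
have e2 : 0 < e / 2 by lra.
have [A HA] := Hl _ e2; have [B HB] := Hm _ e2.
have := HA (A `|` B)%fset (fsubsetUl _ _).
have := HB (A `|` B)%fset (fsubsetUr _ _).
set s := \sum_(x <- _) _ => h1 h2.
have -> : l - m = (s - m) - (s - l) by ring.
apply: le_lt_trans (normcD _ _) _; rewrite normcN; lra.
Qed.

Lemma has_sumD (I : choiceType) (f g : I -> C) (l m : C) :
  has_sum f l -> has_sum g m -> has_sum (fun i => f i + g i) (l + m).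
Proof.
move=> /has_sumP Hl /has_sumP Hm; apply/has_sumP => e e0.
have e2 : 0 < e / 2 by lra.
have [A HA] := Hl _ e2; have [B HB] := Hm _ e2.
exists (A `|` B)%fset => D ABD.
have h1 := HA D (fsubset_trans (fsubsetUl _ _) ABD).
have h2 := HB D (fsubset_trans (fsubsetUr _ _) ABD).
rewrite big_split /= opprD addrACA.
apply: le_lt_trans (normcD _ _) _; lra.
Qed.

Lemma has_sumZ (I : choiceType) (f : I -> C) (l c : C) :
  has_sum f l -> has_sum (fun i => c * f i) (c * l).
Proof.
move=> /has_sumP Hl; apply/has_sumP => e e0.
have c1 : 0 < normc c + 1 by have := normc_ge0 c; lra.
have [A HA] := Hl (e / (normc c + 1)) (divr_gt0 e0 c1).
exists A => B AB; rewrite -mulr_sumr -mulrBr normcM.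
have := HA B AB; rewrite ltr_pdivlMr // => h; apply: le_lt_trans h.
rewrite mulrC ler_wpM2l ?normc_ge0 //; lra.
Qed.

Definition abs_summable (I : choiceType) (f : I -> C) :=
  exists M : R, forall A : {fset I}, \sum_(x <- A) normc (f x) <= M.

Lemma ler_sum_fset (I : choiceType) (g : I -> R) (A B : {fset I}) :
  (forall i, 0 <= g i) -> (A `<=` B)%fset ->
  \sum_(x <- A) g x <= \sum_(x <- B) g x.
Proof.
move=> g0 AB; rewrite (big_fsetID _ (mem A) B) /=.
have -> : [fset x in B | x \in A]%fset = A.
  apply/fsetP => x; rewrite !inE /=; apply/andP/idP => [[]//|xA].
  by split => //; exact: (fsubsetP AB).
by rewrite lerDl sumr_ge0.
Qed.

(** The sum is the supremum of the finite partial sums, which increase with the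
    index set. *)
Lemma nonneg_has_sum (I : choiceType) (g : I -> R) (M : R) :
  (forall i, 0 <= g i) -> (forall A : {fset I}, \sum_(x <- A) g x <= M) ->
  exists l : C, has_sum (fun i => (g i)%:C) l.
Proof.
move=> g0 gM.
set S := [set \sum_(x <- A) g x | A in [set: {fset I}]]%classic.
have S0 : has_sup S.
  split; first by exists (\sum_(x <- fset0) g x); exists fset0.
  by exists M => _ [A _ <-].
exists (sup S)%:C; apply/has_sumP => e e0.
have [_ [A _ <-] HA] := sup_adherent e0 S0; exists A => B AB.
rewrite -rmorph_sum -rmorphB normc_real.
have h1 : \sum_(x <- B) g x <= sup S.
  by apply: ub_le_sup; [case: S0|exists B].
have h2 := ler_sum_fset g0 AB.
rewrite ler0_norm; lra.
Qed.

Lemma Re_normc (z : C) : `|complex.Re z| <= normc z.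
Proof.
by case: z => a b; rewrite /normc /= -sqrtr_sqr ler_sqrt ?lerDl ?addr_ge0 ?sqr_ge0.
Qed.

Lemma Im_normc (z : C) : `|complex.Im z| <= normc z.
Proof.
by case: z => a b; rewrite /normc /= -sqrtr_sqr ler_sqrt ?lerDr ?addr_ge0 ?sqr_ge0.
Qed.

(** Existence of complex sums reduces to the nonnegative case: |z| + Re z,
    |z| + Im z and |z| are nonnegative, bounded by 2|z|, and determine z. *)
Lemma complex_nonneg_parts (z : C) :
  z = (normc z + complex.Re z)%:C + 'i%C * (normc z + complex.Im z)%:C
      + (- 1 - 'i%C) * (normc z)%:C.
Proof.
move: (normc z) => n; case: z => a b; apply/eqP; rewrite eq_complex /=.
by apply/andP; split; apply/eqP; ring.
Qed.

Lemma abs_summable_has_sum (I : choiceType) (f : I -> C) :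
  abs_summable f -> exists l, has_sum f l.
Proof.
case=> M HM.
have H (u : C -> R) : (forall z, `|u z| <= normc z) ->
    exists l, has_sum (fun i => (normc (f i) + u (f i))%:C) l.
  move=> hu; apply: (@nonneg_has_sum _ _ (M + M)) => [i|A].
    by have := hu (f i); rewrite ler_norml => /andP[]; lra.
  rewrite big_split /= lerD //; apply: le_trans (HM A); apply: ler_sum => i _.
  by have := hu (f i); rewrite ler_norml => /andP[].
have [l1 h1] := H _ Re_normc; have [l2 h2] := H _ Im_normc.
have [l3 h3] := nonneg_has_sum (fun i => normc_ge0 (f i)) HM.
exists (l1 + 'i%C * l2 + (- 1 - 'i%C) * l3).
have := has_sumD (has_sumD h1 (has_sumZ (c := 'i%C) h2)) (has_sumZ (c := - 1 - 'i%C) h3).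
by congr has_sum; apply/funext => i; rewrite -complex_nonneg_parts.
Qed.

(** A total sum operator: computations become equations between values, with
    summability needed only as a side condition. *)
Definition Sum (I : choiceType) (f : I -> C) : C :=
  xget 0 [set l | has_sum f l]%classic.

Lemma Sum_has_sum (I : choiceType) (f : I -> C) :
  abs_summable f -> has_sum f (Sum f).
Proof. by move=> /abs_summable_has_sum [l hl]; rewrite /Sum; case: xgetP => // /(_ l). Qed.

Lemma has_sum_Sum (I : choiceType) (f : I -> C) l : has_sum f l -> Sum f = l.
Proof.
move=> hl; rewrite /Sum; case: xgetP => [m _ hm|/(_ l) //].
exact: has_sum_unique hm hl.
Qed.

Lemma eq_Sum (I : choiceType) (f g : I -> C) :
  (forall i, f i = g i) -> Sum f = Sum g.
Proof. by move=> fg; congr Sum; apply/funext. Qed.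

Lemma eq_abs_summable (I : choiceType) (f g : I -> C) :
  (forall i, f i = g i) -> abs_summable f -> abs_summable g.
Proof. by move=> fg; congr abs_summable; apply/funext. Qed.

Lemma abs_summable_le (I : choiceType) (f g : I -> C) (c : R) :
  (forall i, normc (f i) <= c * normc (g i)) ->
  abs_summable g -> abs_summable f.
Proof.
move=> fg [M HM]; exists (`|c| * M) => A.
apply: le_trans (_ : \sum_(x <- A) `|c| * normc (g x) <= _).
  apply: ler_sum => i _; apply: le_trans (fg i) _.
  by rewrite ler_wpM2r ?normc_ge0 ?ler_norm.
by rewrite -mulr_sumr ler_wpM2l.
Qed.

Lemma abs_summableZ (I : choiceType) (f : I -> C) (c : C) :
  abs_summable f -> abs_summable (fun i => c * f i).
Proof. by apply: (@abs_summable_le _ _ _ (normc c)) => i; rewrite normcM. Qed.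

Lemma abs_summableD (I : choiceType) (f g : I -> C) :
  abs_summable f -> abs_summable g -> abs_summable (fun i => f i + g i).
Proof.
move=> [M HM] [M' HM']; exists (M + M') => A.
apply: le_trans (lerD (HM A) (HM' A)); rewrite -big_split /=.
by apply: ler_sum => i _; exact: normcD.
Qed.

Lemma SumD (I : choiceType) (f g : I -> C) :
  abs_summable f -> abs_summable g ->
  Sum (fun i => f i + g i) = Sum f + Sum g.
Proof. by move=> hf hg; apply: has_sum_Sum; apply: has_sumD; exact: Sum_has_sum. Qed.

Lemma SumZ (I : choiceType) (f : I -> C) (c : C) :
  abs_summable f -> Sum (fun i => c * f i) = c * Sum f.
Proof. by move=> hf; apply: has_sum_Sum; apply: has_sumZ; exact: Sum_has_sum. Qed.

Lemma abs_summableB (I : choiceType) (f g : I -> C) :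
  abs_summable f -> abs_summable g -> abs_summable (fun i => f i - g i).
Proof.
move=> hf hg; apply: abs_summableD => //.
by apply: (abs_summable_le (c := 1)) hg => i; rewrite normcN mul1r.
Qed.

Lemma SumB (I : choiceType) (f g : I -> C) :
  abs_summable f -> abs_summable g ->
  Sum (fun i => f i - g i) = Sum f - Sum g.
Proof.
move=> hf hg; apply/eqP; rewrite eq_sym subr_eq -SumD //; last exact: abs_summableB.
by apply/eqP/eq_Sum => i; rewrite subrK.
Qed.

(** A bound on all finite partial sums of moduli passes to the limit. *)
Lemma normc_Sum (I : choiceType) (f : I -> C) (M : R) :
  (forall A : {fset I}, \sum_(x <- A) normc (f x) <= M) -> normc (Sum f) <= M.
Proof.
move=> HM; rewrite leNgt; apply/negP => lt.
have /Sum_has_sum/has_sumP H : abs_summable f by exists M.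
have e0 : 0 < normc (Sum f) - M by lra.
have [A /(_ A (fsubset_refl _)) HA] := H _ e0.
have := HM A; have := normc_sum A f.
have := normc_le_dist (Sum f) (\sum_(x <- A) f x); rewrite normcB.
lra.
Qed.

(** The finite set of indices that controls f is pulled back along phi; the
    indices outside the image contribute nothing. *)
Lemma has_sum_inj (I J : choiceType) (phi : I -> J) (f : J -> C) l :
  injective phi -> (forall j, f j != 0 -> exists i, phi i = j) ->
  has_sum f l -> has_sum (f \o phi) l.
Proof.
move=> inj im /has_sumP H; apply/has_sumP => e e0.
have [A HA] := H _ e0.
have [psi psiP] : exists psi : J -> option I,
    forall j, if psi j is Some i then phi i = j else forall i, phi i <> j.
  suff /choice [psi ?] : forall j, exists o : option I,
    if o is Some i then phi i = j else forall i, phi i <> j by exists psi.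
  move=> j; have [[i hi]|hn] := pselect (exists i, phi i = j).
    by exists (Some i).
  by exists None => i hi; apply: hn; exists i.
exists (seq_fset tt (pmap psi A)) => B AB.
have := HA (A `|` [fset phi i | i in B])%fset (fsubsetUl _ _).
congr (normc (_ - _) < _).
rewrite -(@big_fset_incl _ _ _ _ [fset phi i | i in B]%fset) ?fsubsetUr //=.
  by rewrite big_imfset //= => x y _ _ /inj.
move=> j; rewrite inE => /orP[jA|->//] jB.
apply/eqP/negPn/negP => /im[i ij]; move: jB; rewrite -ij => /negP; apply.
apply/imfsetP; exists i => //=; apply: (fsubsetP AB).
rewrite seq_fsetE mem_pmap; apply/mapP; exists j => //.
by have := psiP j; case: (psi j) => [i' h|/(_ i)]//; congr Some; apply: inj; rewrite ij.
Qed.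

Lemma abs_summable_inj (I J : choiceType) (phi : I -> J) (f : J -> C) :
  injective phi -> abs_summable f -> abs_summable (f \o phi).
Proof.
move=> inj [M HM]; exists M => A; apply: le_trans (HM [fset phi i | i in A]%fset).
by rewrite big_imfset //= => x y _ _ /inj.
Qed.

(** Converse of [abs_summable_inj]: psi, a section of phi over the support of f,
    turns a finite family of indices j with f j nonzero into a finite family of
    indices i. *)
Lemma abs_summable_supp (I J : choiceType) (phi : I -> J) (psi : J -> I)
    (f : J -> C) :
  (forall j, f j != 0 -> phi (psi j) = j) ->
  abs_summable (f \o phi) -> abs_summable f.
Proof.
move=> fphi [M HM]; exists M => A.
pose B := [fset j in A | f j != 0]%fset.
have BA : (B `<=` A)%fset by apply/fsubsetP => j; rewrite !inE => /andP[].
rewrite -(big_fset_incl _ BA); last first.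
  by move=> j jA; rewrite !inE jA /= negbK => /eqP ->; rewrite normc0.
have fB j : j \in B -> phi (psi j) = j by rewrite !inE => /andP[_ /fphi].
apply: le_trans (HM [fset psi j | j in B]%fset); rewrite [leRHS]big_imfset /=; last first.
  by move=> x y /fB ex /fB ey e; rewrite -ex e ey.
by rewrite le_eqVlt; apply/orP; left; apply/eqP; apply: eq_big_seq => j /fB ->.
Qed.

Lemma Sum_inj (I J : choiceType) (phi : I -> J) (f : J -> C) :
  injective phi -> (forall j, f j != 0 -> exists i, phi i = j) ->
  abs_summable f -> Sum f = Sum (f \o phi).
Proof.
by move=> inj im sf; apply/esym/has_sum_Sum/has_sum_inj => //; exact: Sum_has_sum.
Qed.

Lemma Sum_bij (I J : choiceType) (phi : I -> J) (psi : J -> I) (f : J -> C) :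
  cancel phi psi -> cancel psi phi -> abs_summable f ->
  Sum f = Sum (fun i => f (phi i)).
Proof.
move=> c1 c2 sf; apply: Sum_inj => // [|j _]; first exact: can_inj c1.
by exists (psi j).
Qed.

Lemma has_sum_finite (I : choiceType) (f : I -> C) (A : {fset I}) :
  (forall i, i \notin A -> f i = 0) -> has_sum f (\sum_(i <- A) f i).
Proof.
move=> f0; apply/has_sumP => e e0; exists A => B AB.
by rewrite -(big_fset_incl _ AB) ?subrr ?normc0 // => i _ /f0.
Qed.

Lemma abs_summable_prodP (I J : choiceType) (F : I * J -> C) :
  abs_summable F ->
  (forall i, abs_summable (fun j => F (i, j))).
Proof.
move=> sF i.
by apply: (@abs_summable_inj _ _ (fun j => (i, j)) F) => // x y [].
Qed.

Lemma sum_fset_prod (I J : choiceType) (V : zmodType) (F : I * J -> V)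
    (A : {fset I}) (B : {fset J}) :
  \sum_(x <- (A `*` B)%fset) F x = \sum_(i <- A) \sum_(j <- B) F (i, j).
Proof.
by rewrite big_imfset2 //= => -[a b] [c d] _ _ /= [-> ->].
Qed.

Lemma has_sum0 (I : choiceType) : has_sum (fun _ : I => 0 : C) 0.
Proof. by have := @has_sum_finite I (fun=> 0) fset0 (fun _ _ => erefl); rewrite big_seq_fset0. Qed.

Lemma has_sum_big (I J : choiceType) (s : seq I) (F : I -> J -> C) (l : I -> C) :
  (forall i, has_sum (F i) (l i)) ->
  has_sum (fun j => \sum_(i <- s) F i j) (\sum_(i <- s) l i).
Proof.
move=> H; elim: s => [|i s IH].
  rewrite big_nil; have := has_sum0 J; congr has_sum.
  by apply/funext => j; rewrite big_nil.
rewrite big_cons; have := has_sumD (H i) IH; congr has_sum.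
by apply/funext => j; rewrite big_cons.
Qed.

Lemma fsubset_proj (I J : choiceType) (A : {fset I * J}) :
  (A `<=` [fset x.1 | x in A] `*` [fset x.2 | x in A])%fset.
Proof.
apply/fsubsetP => x xA; rewrite in_fsetM.
by apply/andP; split; apply/imfsetP; exists x.
Qed.

(** Fubini for unconditional sums: a finite set of rows is approximated by a
    finite rectangle, which contains the finite set controlling the double sum. *)
Lemma has_sum_prod (I J : choiceType) (F : I * J -> C) l (g : I -> C) :
  has_sum F l -> (forall i, has_sum (fun j => F (i, j)) (g i)) -> has_sum g l.
Proof.
move=> /has_sumP HF Hg; apply/has_sumP => e e0.
have e2 : 0 < e / 2 by lra.
have [A HA] := HF _ e2; exists [fset x.1 | x in A]%fset => B AB.
have /has_sumP/(_ _ e2)[D HD] := @has_sum_big _ _ B (fun i j => F (i, j)) g Hg.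
have := HD (D `|` [fset x.2 | x in A])%fset (fsubsetUl _ _).
set D' := (D `|` _)%fset => h1.
have := HA (B `*` D')%fset.
rewrite sum_fset_prod exchange_big /= => /(_ _) h2.
have {}h2 : normc (\sum_(j <- D') \sum_(i <- B) F (i, j) - l) < e / 2.
  apply: h2; apply: fsubset_trans (fsubset_proj A) _.
  apply/fsubsetP => x; rewrite !in_fsetM => /andP[x1 x2].
  by rewrite (fsubsetP AB) //= inE x2 orbT.
move: h1 h2; set s := \sum_(j <- D') _ => h1 h2.
rewrite normcB in h1.
have -> : \sum_(i <- B) g i - l = (\sum_(i <- B) g i - s) + (s - l) by ring.
apply: le_lt_trans (normcD _ _) _; lra.
Qed.

(** Finitely many row sums are approximated simultaneously by one finite set of
    columns, and the double sum of moduli over the rectangle is bounded. *)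
Lemma abs_summable_Sum (I J : choiceType) (F : I * J -> C) :
  abs_summable F -> abs_summable (fun i => Sum (fun j => F (i, j))).
Proof.
move=> sF; have [M HM] := sF; exists M => A; apply/ler_addgt0Pl => d d0.
suff [D HD] : exists D : {fset J},
    \sum_(i <- A) normc (Sum (fun j => F (i, j))) <=
    d + \sum_(i <- A) \sum_(j <- D) normc (F (i, j)).
  apply: le_trans HD _; rewrite lerD2l.
  by rewrite -(sum_fset_prod (fun x => normc (F x))).
elim: (enum_fset A) d d0 => [|i s IH] d d0.
  by exists fset0; rewrite !big_nil addr0 ltW.
have d2 : 0 < d / 2 by lra.
have [D1 HD1] := IH _ d2.
have /Sum_has_sum/has_sumP/(_ _ d2)[D2 HD2] := abs_summable_prodP sF i.
exists (D1 `|` D2)%fset; rewrite !big_cons.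
have := HD2 _ (fsubsetUr D1 D2); rewrite normcB => /(le_lt_trans (normc_le_dist _ _)).
have := normc_sum (D1 `|` D2)%fset (fun j => F (i, j)).
have : \sum_(i <- s) \sum_(j <- D1) normc (F (i, j)) <=
       \sum_(i <- s) \sum_(j <- (D1 `|` D2)%fset) normc (F (i, j)).
  by apply: ler_sum => k _; apply: ler_sum_fset => [j|]; rewrite ?normc_ge0 ?fsubsetUl.
lra.
Qed.

Lemma Sum_prod (I J : choiceType) (F : I * J -> C) :
  abs_summable F -> Sum F = Sum (fun i => Sum (fun j => F (i, j))).
Proof.
move=> sF; apply/esym/has_sum_Sum; apply: has_sum_prod (Sum_has_sum sF) _ => i.
exact: Sum_has_sum (abs_summable_prodP sF i).
Qed.

Lemma abs_summable_swap (I J : choiceType) (F : I * J -> C) :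
  abs_summable F -> abs_summable (fun x : J * I => F (x.2, x.1)).
Proof.
apply: (@abs_summable_inj _ _ (fun x : J * I => (x.2, x.1))).
by move=> [a b] [c d] [-> ->].
Qed.

Lemma Sum_swap (I J : choiceType) (F : I * J -> C) : abs_summable F ->
  Sum (fun i => Sum (fun j => F (i, j))) = Sum (fun j => Sum (fun i => F (i, j))).
Proof.
move=> sF; rewrite -Sum_prod // (@Sum_bij _ _ (fun x : J * I => (x.2, x.1)) (fun x => (x.2, x.1))) //;
  try by case.
exact: Sum_prod (abs_summable_swap sF).
Qed.

Lemma abs_summable_mul (I J : choiceType) (f : I -> C) (g : J -> C) :
  abs_summable f -> abs_summable g ->
  abs_summable (fun x : I * J => f x.1 * g x.2).
Proof.
move=> [M HM] [M' HM']; exists (M * M') => A.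
apply: le_trans (ler_sum_fset _ (fsubset_proj A)) _ => [x|]; first exact: normc_ge0.
rewrite sum_fset_prod /=.
under eq_bigr do (under eq_bigr do rewrite normcM; rewrite -mulr_sumr).
by rewrite -mulr_suml ler_pM // sumr_ge0 // => *; exact: normc_ge0.
Qed.

Lemma Sum_mul (I J : choiceType) (f : I -> C) (g : J -> C) :
  abs_summable f -> abs_summable g ->
  Sum (fun x : I * J => f x.1 * g x.2) = Sum f * Sum g.
Proof.
move=> sf sg; rewrite Sum_prod /=; last exact: abs_summable_mul.
rewrite mulrC -SumZ //; apply: eq_Sum => i; rewrite SumZ //; exact: mulrC.
Qed.

Lemma Sum_seq (I : choiceType) (f : I -> C) (s : seq I) :
  uniq s -> (forall i, i \notin s -> f i = 0) -> Sum f = \sum_(i <- s) f i.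
Proof.
move=> us f0; have /has_sum_Sum -> : has_sum f (\sum_(i <- seq_fset tt s) f i).
  by apply: has_sum_finite => i; rewrite seq_fsetE => /f0.
by rewrite (perm_big _ (seq_fset_perm tt s)) undup_id.
Qed.

Lemma abs_summable_fin (I : finType) (f : I -> C) : abs_summable f.
Proof.
exists (\sum_(x <- seq_fset tt (enum I)) normc (f x)) => A.
apply: ler_sum_fset => [i|]; first exact: normc_ge0.
by apply/fsubsetP => x _; rewrite seq_fsetE mem_enum.
Qed.

Lemma Sum_recl (f : nat -> C) : abs_summable f -> Sum f = f 0%N + Sum (fun n => f n.+1).
Proof.
move=> sf.
pose g n := if n is 0%N then f 0%N else 0.
pose h n := if n is n'.+1 then f n else 0.
have sg : abs_summable g.
  by apply: (abs_summable_le (c := 1)) sf => -[|n]; rewrite mul1r ?normc0 ?normc_ge0 ?lexx.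
have sh : abs_summable h.
  by apply: (abs_summable_le (c := 1)) sf => -[|n]; rewrite mul1r ?normc0 ?normc_ge0 ?lexx.
rewrite (@eq_Sum _ f (fun n => g n + h n)); last by case=> [|n] /=; rewrite ?addr0 ?add0r.
rewrite SumD //; congr (_ + _).
  by rewrite (@Sum_seq _ _ [:: 0%N]) ?big_seq1 // => -[|n].
rewrite (@Sum_inj _ _ S) //; first by move=> x y [].
by case=> [|n] /=; [rewrite eqxx|exists n].
Qed.

(** The Cauchy product is the double sum re-indexed along the injection
    (s, t) |-> (s + t, s), extended by 0 outside its image s <= k. *)
Lemma Sum_cauchy_summable (F : nat * nat -> C) : abs_summable F ->
  abs_summable (fun x : nat * nat => if (x.2 <= x.1)%N then F (x.2, (x.1 - x.2)%N) else 0).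
Proof.
move=> sF; apply: (@abs_summable_supp _ _ (fun x : nat * nat => ((x.1 + x.2)%N, x.1))
  (fun x : nat * nat => (x.2, (x.1 - x.2)%N))).
  move=> [k s] /=; case: leqP => [sk _|_]; last by rewrite eqxx.
  by rewrite subnKC.
by apply: eq_abs_summable sF => -[s t] /=; rewrite leq_addr addKn.
Qed.

Lemma Sum_cauchy_row (F : nat * nat -> C) k :
  Sum (fun s => if (s <= k)%N then F (s, (k - s)%N) else 0) =
  \sum_(s < k.+1) F (nat_of_ord s, (k - s)%N).
Proof.
rewrite (@Sum_seq _ _ (index_iota 0 k.+1)) ?iota_uniq //; last first.
  by move=> s; rewrite mem_index_iota /= ltnS; case: leqP.
by rewrite big_mkord; apply: eq_bigr => -[s sk] _ /=; rewrite -ltnS sk.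
Qed.

Lemma abs_summable_diag (F : nat * nat -> C) : abs_summable F ->
  abs_summable (fun k => \sum_(s < k.+1) F (nat_of_ord s, (k - s)%N)).
Proof.
move=> sF; apply: eq_abs_summable (abs_summable_Sum (Sum_cauchy_summable sF)) => k.
exact: Sum_cauchy_row.
Qed.

Lemma Sum_cauchy (F : nat * nat -> C) : abs_summable F ->
  Sum F = Sum (fun k => \sum_(s < k.+1) F (nat_of_ord s, (k - s)%N)).
Proof.
move=> sF; have sG := Sum_cauchy_summable sF.
transitivity (Sum (fun x : nat * nat => if (x.2 <= x.1)%N then F (x.2, (x.1 - x.2)%N) else 0)).
  rewrite [RHS](@Sum_inj _ _ (fun x : nat * nat => ((x.1 + x.2)%N, x.1))) //.
  - by apply: eq_Sum => -[s t] /=; rewrite leq_addr addKn.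
  - by move=> [a b] [c d] /= [e1 e2]; congr pair; lia.
  move=> [k s] /=; case: leqP => [sk _|_]; last by rewrite eqxx.
  by exists (s, (k - s)%N); rewrite /= subnKC.
by rewrite Sum_prod //; apply: eq_Sum => k; exact: Sum_cauchy_row.
Qed.

End Sums.

(** * Gaussian majorants and limits *)

Section Gauss.
Variable R : realType.
Local Notation C := R[i].

Lemma abs_summable_partial (f : nat -> C) (M : R) :
  (forall n, \sum_(0 <= k < n) normc (f k) <= M) -> abs_summable f.
Proof.
move=> HM; exists M => A.
have sub : (A `<=` seq_fset tt (index_iota 0 (\sum_(x <- A) x).+1))%fset.
  apply/fsubsetP => x xA; rewrite seq_fsetE mem_index_iota /= ltnS.
  by rewrite (big_fsetD1 x) //= leq_addr.
apply: le_trans (ler_sum_fset _ sub) _ => [i|]; first exact: normc_ge0.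
by rewrite (perm_big _ (seq_fset_perm tt _)) undup_id ?iota_uniq.
Qed.

Lemma geometric_sum_le (r : R) n : 0 <= r < 1 ->
  \sum_(0 <= k < n) r ^+ k <= (1 - r)^-1.
Proof.
move=> /andP[r0 r1]; have h : 0 < 1 - r by lra.
rewrite -[leRHS]mul1r ler_pdivlMr // mulr_suml.
suff -> : \sum_(0 <= i < n) r ^+ i * (1 - r) = 1 - r ^+ n.
  by have := exprn_ge0 n r0; lra.
elim: n => [|n IH]; first by rewrite big_geq // expr0 subrr.
by rewrite big_nat_recr //= IH exprS; ring.
Qed.

Lemma abs_summable_geometric (r : R) : 0 <= r < 1 ->
  abs_summable (fun n : nat => (r ^+ n)%:C).
Proof.
move=> hr; apply: (@abs_summable_partial _ (1 - r)^-1) => n.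
have r0 : 0 <= r by case/andP: hr.
under eq_bigr do rewrite normc_real ger0_norm ?exprn_ge0 //.
exact: geometric_sum_le.
Qed.

Lemma expRN1_lt1 : 0 <= expR (- 1 : R) < 1.
Proof. by rewrite expR_ge0 expR_lt1; apply/andP; split => //; lra. Qed.

(** Completing the square in d|x|^2 - (|a| + 1)|x| absorbs the linear term and
    leaves a geometric decay in |x|. *)
Lemma gauss_le (d a x : R) : 0 < d ->
  expR (- (d * x ^+ 2 + a * x)) <=
  expR ((`|a| + 1) ^+ 2 / (4 * d)) * expR (- `|x|).
Proof.
move=> d0; rewrite -expRD ler_expR.
have d4 : 4 * d != 0 by apply/eqP; lra.
have h : 0 <= d * (`|x| - (`|a| + 1) / (2 * d)) ^+ 2 by rewrite mulr_ge0 ?sqr_ge0 ?ltW.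
have e : d * (`|x| - (`|a| + 1) / (2 * d)) ^+ 2 =
  d * `|x| ^+ 2 - (`|a| + 1) * `|x| + (`|a| + 1) ^+ 2 / (4 * d) by field; apply/eqP; lra.
have ax : - (a * x) <= `|a| * `|x| by rewrite -normrM; apply: le_trans (ler_norm _) _; rewrite normrN.
have x2 : `|x| ^+ 2 = x ^+ 2 by rewrite real_normK ?num_real.
rewrite x2 in e; lra.
Qed.

Lemma gauss_summable_nat (d a : R) : 0 < d ->
  abs_summable (fun n : nat => (expR (- (d * n%:R ^+ 2 + a * n%:R)))%:C).
Proof.
move=> d0; have s := abs_summable_geometric expRN1_lt1.
apply: (abs_summable_le (c := expR ((`|a| + 1) ^+ 2 / (4 * d)))) s => n.
rewrite !normc_real (ger0_norm (expR_ge0 _)) (ger0_norm (exprn_ge0 _ (expR_ge0 _))).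
apply: le_trans (gauss_le _ _ d0) _; rewrite ler_wpM2l ?expR_ge0 //.
by rewrite normr_nat -expRM_natl mulrN1.
Qed.

(** The injection n |-> (|n|, n < 0) reduces the sum over Z to two geometric
    series. *)
Lemma gauss_summable_int (d a : R) : 0 < d ->
  abs_summable (fun n : int => (expR (- (d * n%:~R ^+ 2 + a * n%:~R)))%:C).
Proof.
move=> d0.
have s : abs_summable (fun n : int => ((expR (- 1 : R) ^+ `|n|%N)%:C * 1 : C)).
  apply: (@abs_summable_inj _ _ _ (fun n : int => (`|n|%N, n < 0))
    (fun x => (expR (- 1 : R) ^+ x.1)%:C * (fun=> 1) x.2)).
    by move=> x y [] ; lia.
  exact: (abs_summable_mul (abs_summable_geometric expRN1_lt1)
    (abs_summable_fin (fun _ : bool => 1))).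
apply: (abs_summable_le (c := expR ((`|a| + 1) ^+ 2 / (4 * d)))) s => n.
rewrite mulr1 !normc_real (ger0_norm (expR_ge0 _)) (ger0_norm (exprn_ge0 _ (expR_ge0 _))).
apply: le_trans (gauss_le _ _ d0) _; rewrite ler_wpM2l ?expR_ge0 //.
by rewrite -expRM_natl mulrN1 natr_absz intr_norm.
Qed.

Lemma cvg_normcP (u : nat -> C) (l : C) :
  ((fun n => (u n : C^o)) @ \oo --> (l : C^o))%classic <->
  forall e : R, 0 < e -> exists N, forall n, (N <= n)%N -> normc (u n - l) < e.
Proof.
split => [/cvgrPdist_lt H e e0|H].
  have e0' : (0 : C) < e%:C by rewrite ltcR.
  have [A _ HA] := H _ e0'; exists A => n An.
  by move: (HA n An) => /=; rewrite normr_normc ltcR normcB.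
apply/cvgrPdist_lt => e; rewrite ltcE /= => /andP[/eqP e0 e1].
have [A HA] := H _ e1; exists A => // n /= An.
by rewrite normr_normc ltcE /= e0 eqxx /= normcB HA.
Qed.

Lemma expr_lt_eps (r e : R) : 0 <= r < 1 -> 0 < e ->
  exists N, forall n, (N <= n)%N -> r ^+ n < e.
Proof.
move=> /andP[r0 r1] e0.
have := @cvg_expr R r; rewrite ger0_norm // => /(_ r1) /cvgrPdist_lt/(_ e e0)[N _ HN].
exists N => n /HN /=; rewrite sub0r normrN ger0_norm ?exprn_ge0 //.
Qed.

End Gauss.

(** * Powers of q *)

Section Qpow.
Variables (R : realType) (tau : R[i]).
Local Notation C := R[i].
Local Notation q := (qpow tau).

Lemma cexpD (x y : C) : cexp (x + y) = cexp x * cexp y.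
Proof.
case: x => a b; case: y => c d; rewrite /cexp /=.
rewrite expRD cosD sinD; apply/eqP; rewrite eq_complex /=.
by apply/andP; split; apply/eqP; ring.
Qed.

Lemma normc_cexp (x : C) : normc (cexp x) = expR (complex.Re x).
Proof.
by rewrite /cexp /normc /= !exprMn -mulrDr cos2Dsin2 mulr1 sqrtr_sqr ger0_norm ?expR_ge0.
Qed.

Lemma qpowD r s : q (r + s) = q r * q s.
Proof. by rewrite -cexpD; congr cexp; rewrite rmorphD; ring. Qed.

Lemma qpow0 : q 0 = 1.
Proof.
rewrite /qpow rmorph0 mulr0 mul0r /cexp /= expR0 cos0 sin0.
by apply/eqP; rewrite eq_complex /= mulr1 mulr0 !eqxx.
Qed.

Lemma qpow_neq0 r : q r != 0.
Proof.
apply/eqP => h; have := qpowD r (- r); rewrite subrr qpow0 h mul0r => /eqP.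
by rewrite oner_eq0.
Qed.

Lemma qpowN r : q (- r) = (q r)^-1.
Proof.
by apply: (mulfI (qpow_neq0 r)); rewrite -qpowD subrr qpow0 mulfV ?qpow_neq0.
Qed.

Lemma qpowX r n : q r ^+ n = q (n%:R * r).
Proof.
elim: n => [|n IH]; first by rewrite mul0r qpow0.
by rewrite exprS IH -qpowD; congr q; rewrite -natr1; ring.
Qed.

Let t := 2 * pi * complex.Im tau.

Lemma normc_qpow r : normc (q r) = expR (- (t * ratr r)).
Proof.
rewrite /qpow normc_cexp; congr expR.
have -> : (ratr r : C) = (ratr r : R)%:C by rewrite fmorph_rat.
have -> : ('i : C)%R = 'i%C by [].
have -> : (2 : C) = (2 : R)%:C by rewrite rmorph_nat.
by rewrite /t; case: tau => a b /=; ring.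
Qed.

End Qpow.

(** * Euler's expansion of the infinite product *)

Section Euler.
Variables (R : realType) (tau : R[i]) (h : rat).
Hypothesis htau : 0 < complex.Im tau.
Hypothesis h0 : 0 < h.
Local Notation C := R[i].
Local Notation q := (qpow tau).
Local Notation Q := (qpow tau (2 * h)).
Local Notation P := (qpoch Q Q).

Lemma qpochS (x p : C) n : qpoch x p n.+1 = qpoch x p n * (1 - x * p ^+ n).
Proof. by rewrite /qpoch big_nat_recr. Qed.

Lemma qpochSl (x p : C) n : qpoch x p n.+1 = (1 - x) * qpoch (x * p) p n.
Proof.
rewrite /qpoch big_nat_recl //= expr0 mulr1; congr (_ * _).
by apply: eq_bigr => i _; rewrite exprS mulrA.
Qed.

Lemma qpoch0 (x p : C) : qpoch x p 0 = 1.
Proof. by rewrite /qpoch big_geq. Qed.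

Lemma im_gt0 : 0 < 2 * pi * complex.Im tau.
Proof. by rewrite !mulr_gt0 // pi_gt0. Qed.

Lemma normc_qpow_lt1 r : 0 < r -> normc (q r) < 1.
Proof.
by move=> r0; rewrite normc_qpow expR_lt1 oppr_lt0 mulr_gt0 ?im_gt0 ?ltr0q.
Qed.

Lemma normcQ_lt1 : 0 <= normc Q < 1.
Proof. by rewrite normc_ge0 normc_qpow_lt1 // mulr_gt0. Qed.

Lemma normc_1sub_ge (x : C) : 1 - normc x <= normc (1 - x).
Proof. by have := normc_le_dist 1 x; rewrite normc1. Qed.

Lemma normcQX_le n : normc (Q ^+ n.+1) <= normc Q.
Proof.
have /andP[r0 r1] := normcQ_lt1.
by rewrite normcX exprS ler_piMr // exprn_ile1 // ltW.
Qed.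

Lemma one_subQX_neq0 n : 1 - Q ^+ n.+1 != 0.
Proof.
rewrite -normc_eq0; have := normc_1sub_ge (Q ^+ n.+1); have := normcQX_le n.
by have /andP[r0 r1] := normcQ_lt1; lra.
Qed.

Lemma qpochQS n : P n.+1 = P n * (1 - Q ^+ n.+1).
Proof. by rewrite qpochS -exprS. Qed.

Lemma qpochQ_neq0 n : P n != 0.
Proof.
elim: n => [|n IH]; first by rewrite qpoch0 oner_eq0.
by rewrite qpochQS mulf_neq0 ?one_subQX_neq0.
Qed.

(** With r = |Q|, each factor satisfies
    1/(1 - r^(n+1)) <= 1 + r^n/(1 - r) <= exp(r^n/(1 - r)), so the logarithm of
    the product is dominated by a geometric series. *)
Lemma inv_qpochQ_bounded : exists2 K : R, 0 < K & forall n, normc (P n)^-1 <= K.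
Proof.
have /andP[r0 r1] := normcQ_lt1; set r := normc Q in r0 r1.
have d0 : 0 < 1 - r by lra.
have H n : normc (P n)^-1 <= expR ((1 - r)^-1 * \sum_(0 <= k < n) r ^+ k).
  elim: n => [|n IH]; first by rewrite qpoch0 invr1 normc1 big_geq // mulr0 expR0.
  rewrite qpochQS invfM normcM big_nat_recr //= mulrDr expRD.
  apply: ler_pM; rewrite ?normc_ge0 // normcV.
  have y0 : 0 <= r ^+ n by rewrite exprn_ge0.
  have b1 := normc_1sub_ge (Q ^+ n.+1).
  have z1 : r ^+ n.+1 <= r ^+ n by rewrite exprS ler_piMl // ltW.
  have z2 : r ^+ n.+1 <= r by have := normcQX_le n; rewrite normcX.
  rewrite normcX -/r in b1.
  move: (r ^+ n.+1) (r ^+ n) (normc (1 - _)) b1 y0 z1 z2 => z y c b1 y0 z1 z2.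
  apply: le_trans (expR_ge1Dx _).
  have c0 : 0 < c by lra.
  have e0 : 0 <= (1 - r)^-1 * y by rewrite mulr_ge0 // invr_ge0 ltW.
  have e1 : (1 - r)^-1 * y * (1 - r) = y by field; apply/eqP; lra.
  rewrite -[leLHS]mul1r ler_pdivrMr //.
  nra.
exists (expR ((1 - r)^-1 * (1 - r)^-1)); first exact: expR_gt0.
move=> n; apply: le_trans (H n) _; rewrite ler_expR ler_wpM2l ?invr_ge0 ?(ltW d0) //.
exact: geometric_sum_le normcQ_lt1.
Qed.

Lemma normc_qquad (d b : rat) (x : rat) :
  normc (q (d * x ^+ 2 + b * x)) =
  expR (- ((2 * pi * complex.Im tau * ratr d) * ratr x ^+ 2
           + (2 * pi * complex.Im tau * ratr b) * ratr x)).
Proof. by rewrite normc_qpow !(rmorphD, rmorphM, rmorphXn) /=; congr expR; ring. Qed.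

Lemma qnat_summable (d b : rat) : 0 < d ->
  abs_summable (fun n : nat => q (d * n%:R ^+ 2 + b * n%:R)).
Proof.
move=> d0.
have d1 : 0 < 2 * pi * complex.Im tau * ratr d by rewrite mulr_gt0 ?im_gt0 ?ltr0q.
have := gauss_summable_nat (2 * pi * complex.Im tau * ratr b) d1.
apply: (abs_summable_le (c := 1)) => n.
by rewrite mul1r normc_real ger0_norm ?expR_ge0 // normc_qquad ratr_nat.
Qed.

Lemma qint_summable (d b : rat) : 0 < d ->
  abs_summable (fun n : int => q (d * n%:~R ^+ 2 + b * n%:~R)).
Proof.
move=> d0.
have d1 : 0 < 2 * pi * complex.Im tau * ratr d by rewrite mulr_gt0 ?im_gt0 ?ltr0q.
have := gauss_summable_int (2 * pi * complex.Im tau * ratr b) d1.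
apply: (abs_summable_le (c := 1)) => n.
by rewrite mul1r normc_real ger0_norm ?expR_ge0 // normc_qquad ratr_int.
Qed.

Lemma euler_summable (x : C) :
  abs_summable (fun n => q (h * (n%:R ^+ 2 - n%:R)) * x ^+ n / P n).
Proof.
have [K K0 HK] := inv_qpochQ_bounded.
have d1 : 0 < 2 * pi * complex.Im tau * ratr h by rewrite mulr_gt0 ?im_gt0 ?ltr0q.
have := gauss_summable_nat (- (2 * pi * complex.Im tau * ratr h) - normc x) d1.
apply: (abs_summable_le (c := K)) => n.
rewrite normc_real ger0_norm ?expR_ge0 // normcM mulrC.
apply: ler_pM; rewrite ?normc_ge0 // normcM.
apply: le_trans (_ : normc (q (h * n%:R ^+ 2 + - h * n%:R)) * expR (n%:R * normc x) <= _).
  rewrite (_ : h * n%:R ^+ 2 + - h * n%:R = h * (n%:R ^+ 2 - n%:R)); last by ring.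
  rewrite ler_wpM2l ?normc_ge0 // normcX expRM_natl lerXn2r ?nnegrE ?expR_ge0 ?normc_ge0 //.
  by apply: le_trans (expR_ge1Dx _); rewrite lerDr.
rewrite normc_qquad ratr_nat rmorphN /= -expRD ler_expR; lra.
Qed.

(** Euler's series for (-x;Q)_oo, as Q^(n(n-1)/2) = q^(h(n^2-n)). *)
Definition euler (x : C) := Sum (fun n => q (h * (n%:R ^+ 2 - n%:R)) * x ^+ n / P n).

(** The factor 1 - Q^n kills the term n = 0 and cancels the last factor of
    (Q;Q)_n: this is how all the q-difference equations below arise. *)
Lemma Sum_shift (g : nat -> C) :
  abs_summable (fun n => (1 - Q ^+ n) * g n / P n) ->
  Sum (fun n => (1 - Q ^+ n) * g n / P n) = Sum (fun n => g n.+1 / P n).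
Proof.
move=> s; rewrite Sum_recl // expr0 subrr !mul0r add0r; apply: eq_Sum => n.
by rewrite qpochQS invfM; field; rewrite qpochQ_neq0 one_subQX_neq0.
Qed.

Lemma euler_fun (x : C) : euler x = (1 + x) * euler (x * Q).
Proof.
have s1 := euler_summable x; have s2 := euler_summable (x * Q).
suff H : euler x - euler (x * Q) = x * euler (x * Q).
  by rewrite (mulrDl 1 x) mul1r -H addrC subrK.
rewrite /euler -(SumB s1 s2) -(SumZ _ s2).
have e n : q (h * (n%:R ^+ 2 - n%:R)) * x ^+ n / P n -
    q (h * (n%:R ^+ 2 - n%:R)) * (x * Q) ^+ n / P n =
    (1 - Q ^+ n) * (q (h * (n%:R ^+ 2 - n%:R)) * x ^+ n) / P n.
  by rewrite exprMn; ring.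
rewrite (eq_Sum e) Sum_shift; last first.
  exact: eq_abs_summable e (abs_summableB s1 s2).
apply: eq_Sum => n; rewrite exprMn (exprS x) qpowX.
have -> : h * (n.+1%:R ^+ 2 - n.+1%:R) = h * (n%:R ^+ 2 - n%:R) + n%:R * (2 * h).
  by rewrite -natr1; ring.
by rewrite qpowD; ring.
Qed.

Lemma euler_qpoch (x : C) n : euler x = qpoch (- x) Q n * euler (x * Q ^+ n).
Proof.
elim: n => [|n IH]; first by rewrite qpoch0 expr0 mulr1 mul1r.
by rewrite IH qpochS euler_fun exprSr mulNr opprK -!mulrA.
Qed.

(** As n grows the argument x Q^n tends to 0, where the series has value 1; every
    other term gains at least a factor |Q|^n. *)
Lemma euler_near1 (x : C) : exists2 M : R, 0 < M &
  forall n, normc (euler (x * Q ^+ n) - 1) <= M * normc Q ^+ n.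
Proof.
have [M HM] := abs_summable_inj succn_inj (euler_summable x).
have M0 : 0 <= M by have := HM fset0; rewrite big_seq_fset0.
exists (M + 1); first lra.
have /andP[r0 r1] := normcQ_lt1.
move=> n; rewrite /euler (Sum_recl (euler_summable _)).
rewrite qpoch0 expr0 expr0n /= subrr mulr0 qpow0 mulr1 divr1 addrC addKr.
apply: normc_Sum => A.
apply: le_trans (_ : M * normc Q ^+ n <= _); last first.
  by rewrite ler_wpM2r ?exprn_ge0 //; lra.
apply: le_trans (ler_wpM2r (exprn_ge0 n r0) (HM A)).
rewrite mulr_suml; apply: ler_sum => k _ /=.
rewrite exprMn mulrA mulrAC normcM ler_wpM2l ?normc_ge0 //.
by rewrite -exprM normcX mulnS exprD ler_piMr ?exprn_ge0 // exprn_ile1 // ltW.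
Qed.

(** The error |u - u v| is |u| |1 - v|, and |v| >= 1/2 bounds |u| by twice the
    modulus of the product u v. *)
Lemma normc_quotient_near (E u v : C) (e : R) : E = u * v ->
  normc (v - 1) < 2^-1 -> normc (v - 1) < e / (4 * (normc E + 1)) ->
  normc (u - E) < e.
Proof.
move=> -> h1 h2; have -> : u - u * v = u * (1 - v) by ring.
have h3 : 2^-1 <= normc v by have := normc_le_dist 1 v; rewrite normc1 normcB; lra.
move: h1 h2; rewrite !normcM (normcB 1 v).
have : 0 <= normc (v - 1) := normc_ge0 _; have : 0 <= normc u := normc_ge0 _.
move: (normc u) (normc v) (normc (v - 1)) h3 => a b c h3 a0 c0 h1.
have ab : a * 2^-1 <= a * b by rewrite ler_wpM2l.
rewrite ltr_pdivlMr => [h2|]; last lra.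
nra.
Qed.

(** The functional equation gives E(-x) = (x;Q)_n E(-x Q^n), and the last factor
    tends to 1; convergence of the product and its value come out together. *)
Lemma qpoch_cvg (x : C) :
  ((fun n => (qpoch x Q n : C^o)) @ \oo --> (euler (- x) : C^o))%classic.
Proof.
apply/cvg_normcP => e e0.
have [M M0 HM] := euler_near1 (- x).
have H n := euler_qpoch (- x) n; rewrite opprK in H.
have E0 := normc_ge0 (euler (- x)).
(* The two tolerances required by [normc_quotient_near]. *)
pose d := Num.min (2^-1) (e / (4 * (normc (euler (- x)) + 1))).
have d0 : 0 < d.
  rewrite lt_min; apply/andP; split; first lra.
  by apply: divr_gt0 => //; lra.
have [N HN] := expr_lt_eps normcQ_lt1 (divr_gt0 d0 M0).
exists N => n /HN; rewrite ltr_pdivlMr // mulrC => hn.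
have := le_lt_trans (HM n) hn; rewrite /d lt_min => /andP[].
exact: normc_quotient_near.
Qed.

Lemma qpoch_infE (x : C) : qpoch_inf x Q = euler (- x).
Proof. exact: (@cvg_lim C^o (@norm_hausdorff _ _) _ _ _ _ _ (@qpoch_cvg x)). Qed.

End Euler.

(** * Durfee rectangle sums *)

Section Durfee.
Variables (R : realType) (tau : R[i]) (h : rat).
Hypothesis htau : 0 < complex.Im tau.
Hypothesis h0 : 0 < h.
Local Notation C := R[i].
Local Notation q := (qpow tau).
Local Notation Q := (qpow tau (2 * h)).
Local Notation P := (qpoch Q Q).
Local Notation J := (qpoch_inf Q Q).

Lemma qpoch_inf_cvg (x : C) :
  ((fun n => (qpoch x Q n : C^o)) @ \oo --> (qpoch_inf x Q : C^o))%classic.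
Proof. by rewrite qpoch_infE //; exact: qpoch_cvg. Qed.

Lemma cvg_complex_unique (u : nat -> C) (l m : C) :
  ((fun n => (u n : C^o)) @ \oo --> (l : C^o))%classic ->
  ((fun n => (u n : C^o)) @ \oo --> (m : C^o))%classic -> l = m.
Proof. by apply: cvg_unique; exact: norm_hausdorff. Qed.

Lemma qpoch_inf_shift (x : C) n :
  qpoch_inf x Q = qpoch x Q n * qpoch_inf (x * Q ^+ n) Q.
Proof. by rewrite !qpoch_infE // (euler_qpoch htau h0 _ n) opprK mulNr. Qed.

(** Euler's expansion at a power of q, the form in which it is summed. *)
Lemma eulerE (b : rat) :
  Sum (fun n : nat => q (h * n%:R ^+ 2 + b * n%:R) / P n) =
  qpoch_inf (- q (h + b)) Q.
Proof.
rewrite qpoch_infE // opprK; apply: eq_Sum => n; rewrite qpowX -qpowD.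
by congr (q _ / _); ring.
Qed.

(** The sum over n of Q^(n^2 + tn) / ((Q;Q)_n (Q;Q)_(n+a)).  At t = a it counts
    partitions by their Durfee rectangle, of shape n by n + a. *)
Definition durfee (a : nat) (t : rat) : C :=
  Sum (fun n : nat => q (2 * h * (n%:R ^+ 2 + t * n%:R)) / (P n * P (n + a))).

Lemma durfee_Sum a t : durfee a t =
  Sum (fun n : nat => q (2 * h * (n%:R ^+ 2 + t * n%:R)) / (P n * P (n + a))).
Proof. by []. Qed.

Lemma durfee_le : exists K : R, forall (d : rat) n m,
  normc (q d / (P n * P m)) <= K * normc (q d).
Proof.
have [K K0 HK] := inv_qpochQ_bounded htau h0.
exists (K * K) => d n m; rewrite normcM mulrC ler_wpM2r ?normc_ge0 //.
by rewrite invfM normcM ler_pM ?normc_ge0.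
Qed.

Lemma durfee_summable (a : nat) (t : rat) :
  abs_summable (fun n : nat => q (2 * h * (n%:R ^+ 2 + t * n%:R)) / (P n * P (n + a))).
Proof.
have [K HK] := durfee_le.
have h2 : 0 < 2 * h by rewrite mulr_gt0.
have := qnat_summable htau (2 * h * t) h2; apply: (abs_summable_le (c := K)) => n.
apply: le_trans (HK _ _ _) _.
by rewrite (_ : 2 * h * (n%:R ^+ 2 + t * n%:R) = 2 * h * n%:R ^+ 2 + 2 * h * t * n%:R) //; ring.
Qed.

(** Writing 1 = Q^n + (1 - Q^n) in the general term; the second part is shifted by
    [Sum_shift]. *)
Lemma durfee_shift (a : nat) (t : rat) :
  durfee a t = durfee a (t + 1) + q (2 * h * (t + 1)) * durfee a.+1 (t + 2).
Proof.
have s1 := durfee_summable a t; have s2 := durfee_summable a (t + 1).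
have s3 := durfee_summable a.+1 (t + 2).
apply/eqP; rewrite addrC -subr_eq; apply/eqP.
rewrite /durfee -(SumB s1 s2) -(SumZ _ s3).
pose g n := q (2 * h * (n%:R ^+ 2 + t * n%:R)) / P (n + a).
have e n : q (2 * h * (n%:R ^+ 2 + t * n%:R)) / (P n * P (n + a)) -
   q (2 * h * (n%:R ^+ 2 + (t + 1) * n%:R)) / (P n * P (n + a)) =
   (1 - Q ^+ n) * g n / P n.
  rewrite /g qpowX; have -> : 2 * h * (n%:R ^+ 2 + (t + 1) * n%:R) =
    2 * h * (n%:R ^+ 2 + t * n%:R) + n%:R * (2 * h) by ring.
  by rewrite qpowD invfM; ring.
rewrite (eq_Sum e) Sum_shift //; last first.
  exact: eq_abs_summable e (abs_summableB s1 s2).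
apply: eq_Sum => n; rewrite /g addSnnS mulrA -qpowD invfM mulrA mulrAC.
by congr (q _ / _ / _); rewrite -natr1; ring.
Qed.

(** Here 1/(Q;Q)_(n+a) is rewritten as (1 - Q^(n+a+1))/(Q;Q)_(n+a+1). *)
Lemma durfee_row (a : nat) (t : rat) :
  durfee a t = durfee a.+1 t - q (2 * h * a.+1%:R) * durfee a.+1 (t + 1).
Proof.
have s1 := durfee_summable a.+1 t; have s2 := durfee_summable a.+1 (t + 1).
rewrite /durfee -(SumZ _ s2) -(SumB s1); last exact: abs_summableZ.
apply: eq_Sum => n; rewrite addnS qpochQS qpowX.
have -> : 2 * h * (n%:R ^+ 2 + (t + 1) * n%:R) =
    2 * h * (n%:R ^+ 2 + t * n%:R) + n%:R * (2 * h) by ring.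
have -> : (n + a).+1%:R * (2 * h) = n%:R * (2 * h) + 2 * h * a.+1%:R.
  by rewrite -addnS natrD; ring.
have := one_subQX_neq0 htau h0 (n + a); rewrite qpowX -addnS natrD mulrDl.
rewrite (mulrC a.+1%:R) !qpowD => nz.
by field; rewrite !qpochQ_neq0 //= nz.
Qed.

Opaque durfee.

(** For t = a the exponent n^2 + an is at least n^2, whatever a is. *)
Lemma durfee_bounded : exists M : R, forall a : nat, normc (durfee a a%:R) <= M.
Proof.
have [K HK] := durfee_le.
have h2 : 0 < 2 * h by rewrite mulr_gt0.
have [M HM] := qnat_summable htau 0 h2.
exists (`|K| * M) => a; rewrite durfee_Sum; apply: normc_Sum => A.
apply: le_trans (_ : `|K| * \sum_(n <- A) normc (q (2 * h * n%:R ^+ 2 + 0 * n%:R)) <= _); last first.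
  by rewrite ler_wpM2l.
rewrite mulr_sumr; apply: ler_sum => n _.
apply: le_trans (HK _ _ _) _.
apply: le_trans (ler_wpM2r (normc_ge0 _) (ler_norm _)) _.
rewrite ler_wpM2l // !normc_qpow ler_expR lerN2 ler_wpM2l ?(ltW (im_gt0 htau)) //.
rewrite ler_rat mul0r addr0 ler_wpM2l ?(ltW h2) //.
by rewrite lerDl mulr_ge0.
Qed.

(** The recurrence shrinks the difference of consecutive terms: |D_b - D_(b+1)|
    is at most r^n times a bound on |D_(b+n) - D_(b+n+1)|, for every n. *)
Lemma contracting_const (D c : nat -> C) (r M : R) :
  0 <= r < 1 -> (forall b, normc (c b) <= r) -> (forall b, normc (D b) <= M) ->
  (forall b, D b - D b.+1 = c b * (D b.+1 - D b.+2)) ->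
  forall a, D a = D 0%N.
Proof.
move=> hr hc HM rec; have [r0 r1] := andP hr.
have H n : forall b, normc (D b - D b.+1) <= r ^+ n * (2 * M).
  elim: n => [|n IH] b.
    rewrite expr0 mul1r; apply: le_trans (normcD _ _) _; rewrite normcN.
    by have := HM b; have := HM b.+1; lra.
  rewrite rec normcM exprS -(mulrA r).
  by apply: ler_pM; rewrite ?normc_ge0 // hc.
have E b : D b = D b.+1.
  apply/eqP; rewrite -subr_eq0; apply/eqP; apply: normc_lt_eps_eq0 => e e0.
  have M0 : 0 <= M := le_trans (normc_ge0 _) (HM 0%N).
  have M1 : 0 < 2 * M + 1 by lra.
  have [N HN] := expr_lt_eps hr (divr_gt0 e0 M1).
  apply: le_lt_trans (H N b) _; have := HN N (leqnn _).
  rewrite ltr_pdivlMr //; have : 0 <= r ^+ N by rewrite exprn_ge0.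
  by move: (r ^+ N) => y; nra.
by elim=> // a <-.
Qed.

(** Combining the two recurrences at t = a makes the consecutive differences
    satisfy the contraction of [contracting_const]. *)
Lemma durfee_const (a : nat) : durfee a a%:R = durfee 0 0.
Proof.
have [M HM] := durfee_bounded.
apply: (contracting_const (D := fun a => durfee a a%:R)
  (c := fun b => - q (2 * h * b.+1%:R)) (normcQ_lt1 htau h0) _ HM) => b.
  rewrite normcN (mulrC (2 * h)) -(qpowX _ (2 * h)).
  exact: (normcQX_le htau h0 b).
have e1 : (b%:R + 1 : rat) = b.+1%:R by rewrite natr1.
have e2 : (b%:R + 2 : rat) = b.+2%:R by rewrite -!natr1; ring.
rewrite (durfee_row b b%:R) (durfee_shift b.+1 b%:R) e1 e2.
by move: (q _) (durfee _ _) (durfee _ _) => *; ring.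
Qed.

(** The common value is found by letting a tend to infinity: the term n = 0 is
    1/(Q;Q)_a, and the others are O(|Q|^a). *)
Lemma qpoch_inf_durfee : J * durfee 0 0 = 1.
Proof.
have [K HK] := durfee_le.
have h2 : 0 < 2 * h by rewrite mulr_gt0.
have [M HM] := qnat_summable htau 0 h2.
have M0 : 0 <= M by have := HM fset0; rewrite big_seq_fset0.
have [r0 r1] := andP (normcQ_lt1 htau h0).
have H a : normc (durfee 0 0 - (P a)^-1) <= `|K| * M * normc Q ^+ a.
  rewrite -(durfee_const a) durfee_Sum (Sum_recl (durfee_summable _ _)).
  have -> : 2 * h * (0%:R ^+ 2 + a%:R * 0%:R) = 0 by ring.
  rewrite qpow0 qpoch0 !mul1r add0n addrAC subrr add0r.
  apply: normc_Sum => A; rewrite mulrAC.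
  apply: le_trans (ler_wpM2l _ (HM A)); last by rewrite mulr_ge0 ?exprn_ge0.
  rewrite mulr_sumr; apply: ler_sum => n _.
  apply: le_trans (HK _ _ _) _.
  apply: le_trans (ler_wpM2r (normc_ge0 _) (ler_norm _)) _.
  rewrite -(mulrA `|K|) ler_wpM2l // -normcX -normcM qpowX -qpowD.
  rewrite !normc_qpow ler_expR lerN2 ler_wpM2l ?(ltW (im_gt0 htau)) //.
  rewrite ler_rat -subr_ge0 -natr1.
  rewrite (_ : _ - _ = 2 * h * (a%:R * n%:R + 2 * n%:R + 1)); last by ring.
  by rewrite mulr_ge0 ?(ltW h2) // !addr_ge0 ?mulr_ge0.
have cinv : ((fun n => ((P n)^-1 : C^o)) @ \oo --> (durfee 0 0 : C^o))%classic.
  apply/cvg_normcP => e e0.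
  have M1 : 0 < `|K| * M + 1 by rewrite ltr_wpDl ?mulr_ge0.
  have [N HN] := expr_lt_eps (normcQ_lt1 htau h0) (divr_gt0 e0 M1).
  exists N => n /HN; rewrite ltr_pdivlMr // normcB => hn.
  apply: le_lt_trans (H n) _; apply: le_lt_trans hn.
  by rewrite mulrC ler_wpM2l ?exprn_ge0 // lerDl.
have lim_prod : ((fun n => (P n * (P n)^-1 : C^o)) @ \oo -->
    (J * durfee 0 0 : C^o))%classic.
  by apply: cvgM cinv; exact: qpoch_inf_cvg.
apply: (cvg_complex_unique lim_prod); apply/cvg_normcP => e e0; exists 0%N => n _.
by rewrite mulfV ?qpochQ_neq0 // subrr normc0.
Qed.

Lemma qpoch_infQ_neq0 : J != 0.
Proof. by apply/eqP => J0; have := qpoch_inf_durfee; rewrite J0 mul0r => /esym/eqP; rewrite oner_eq0. Qed.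

End Durfee.

(** * Jacobi's triple product and the coefficient of a fixed difference *)

Opaque Sum durfee qpoch_inf qpow qpoch.

(** A pair of natural numbers is recorded as its difference and its minimum. *)
Definition pair_of_diff (x : int * nat) : nat * nat :=
  match x.1 with
  | Posz n => ((x.2 + n)%N, x.2)
  | Negz n => (x.2, (x.2 + n.+1)%N)
  end.

Definition diff_of_pair (x : nat * nat) : int * nat := (x.1%:Z - x.2%:Z, minn x.1 x.2).

Lemma pair_of_diffK : cancel pair_of_diff diff_of_pair.
Proof.
move=> [[n|n] m] /=; rewrite /diff_of_pair /pair_of_diff /=; congr pair; rewrite ?NegzE; lia.
Qed.

Lemma diff_of_pairK : cancel diff_of_pair pair_of_diff.
Proof.
move=> [s t]; rewrite /diff_of_pair /pair_of_diff /=.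
have [ts|st] := leqP t s.
  rewrite (_ : s%:Z - t%:Z = (s - t)%N%:Z); last lia.
  by congr pair; lia.
rewrite (_ : s%:Z - t%:Z = Negz (t - s).-1); last by rewrite NegzE; lia.
by congr pair; lia.
Qed.

Section Theta.
Variables (R : realType) (tau : R[i]) (h : rat).
Hypothesis htau : 0 < complex.Im tau.
Hypothesis h0 : 0 < h.
Local Notation C := R[i].
Local Notation q := (qpow tau).
Local Notation Q := (qpow tau (2 * h)).
Local Notation P := (qpoch Q Q).
Local Notation J := (qpoch_inf Q Q).

(** The q-binomial sum over s of [k choose s] Q^(as - s(k-s)), divided by
    (Q;Q)_k. *)
Definition qbinsum (a k : nat) : C :=
  \sum_(s < k.+1) q (2 * h * (a%:R * s%:R - s%:R * (k - s)%:R)) / (P s * P (k - s)).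

(** The q-Pascal rule: 1 - Q^(k+1) = Q^s (1 - Q^(k+1-s)) + (1 - Q^s), and each part
    cancels a factor of one of the two denominators. *)
Lemma qbinsumS a k : (1 - Q ^+ k.+1) * qbinsum a k.+1 =
  qbinsum a k + q (2 * h * (a%:R - k%:R)) * qbinsum a.+1 k.
Proof.
pose F s := q (2 * h * (a%:R * s%:R - s%:R * (k.+1 - s)%:R)) / (P s * P (k.+1 - s)).
rewrite {1}/qbinsum mulr_sumr.
rewrite (eq_bigr (fun s : 'I_k.+2 => Q ^+ s * (1 - Q ^+ (k.+1 - s)) * F s + (1 - Q ^+ s) * F s)); last first.
  move=> [s sk] _ /=; rewrite -/(F s) ltnS in sk *.
  have -> : Q ^+ k.+1 = Q ^+ s * Q ^+ (k.+1 - s) by rewrite -exprD subnKC.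
  by move: (F s) (Q ^+ s) (Q ^+ (k.+1 - s)) => x y z; ring.
rewrite big_split /=; congr (_ + _).
  rewrite big_ord_recr /= subnn expr0 subrr mulr0 mul0r addr0.
  apply: eq_bigr => -[s /=]; rewrite ltnS => sk _.
  rewrite /F subSn // qpochQS qpowX.
  have := one_subQX_neq0 htau h0 (k - s); have := qpochQ_neq0 htau h0 (k - s); have := qpochQ_neq0 htau h0 s.
  have -> : q (2 * h * (a%:R * s%:R - s%:R * (k - s)%:R)) =
    q (s%:R * (2 * h)) * q (2 * h * (a%:R * s%:R - s%:R * (k - s).+1%:R)).
    by rewrite -qpowD; congr q; rewrite -natr1; ring.
  by move: (q _) (q _) (P s) (P _) (Q ^+ _) => x y u v z u0 v0 z0; field; rewrite z0 v0 u0.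
rewrite big_ord_recl /= expr0 subrr mul0r add0r mulr_sumr.
apply: eq_bigr => -[s /=]; rewrite ltnS => sk _; rewrite /bump add1n /F subSS qpochQS.
have := one_subQX_neq0 htau h0 s; have := qpochQ_neq0 htau h0 (k - s); have := qpochQ_neq0 htau h0 s.
have -> : q (2 * h * (a%:R * s.+1%:R - s.+1%:R * (k - s)%:R)) =
  q (2 * h * (a%:R - k%:R)) * q (2 * h * (a.+1%:R * s%:R - s%:R * (k - s)%:R)).
  by rewrite -qpowD -{2}(subnKC sk); congr q; rewrite natrD -!natr1; ring.
by move: (q _) (q _) (P s) (P _) (Q ^+ _) => x y u v z u0 v0 z0; field; rewrite z0 v0 u0.
Qed.

(** Both sides satisfy the recurrence of [durfee_shift] at t = a - k - 1, and
    agree at k = 0. *)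
Lemma durfee_below a k : J * durfee tau h a (a%:R - k%:R) = P k * qbinsum a k.
Proof.
elim: k a => [|k IH] a.
  rewrite subr0 durfee_const // qpoch_inf_durfee // qpoch0 /qbinsum big_ord_recl big_ord0 /= subnn.
  have -> : 2 * h * (a%:R * 0%:R - 0%:R * 0%:R) = 0 by ring.
  by rewrite qpow0 qpoch0 !mulr1 divr1 addr0 mul1r.
rewrite durfee_shift //.
have -> : (a%:R - k.+1%:R + 1 : rat) = a%:R - k%:R by rewrite -natr1; ring.
have -> : (a%:R - k.+1%:R + 2 : rat) = a.+1%:R - k%:R by rewrite -!natr1; ring.
rewrite (qpochQS tau h k) -(mulrA (P k)) (qbinsumS a k).
move: (IH a) (IH a.+1); move: (durfee tau h a _) (durfee tau h a.+1 _) (qbinsum a k) (qbinsum a.+1 k).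
by move: (P k) (q _) J => p c j x y u v e1 e2; rewrite mulrDr mulrCA e1 e2; ring.
Qed.

Lemma eulerq_summable b :
  abs_summable (fun n : nat => q (h * n%:R ^+ 2 + b * n%:R) / P n).
Proof.
apply: eq_abs_summable (euler_summable htau h0 (q (h + b))) => n.
by rewrite qpowX -qpowD; congr (q _ / _); ring.
Qed.

Lemma euler_mul b c :
  Sum (fun x : nat * nat => (q (h * x.1%:R ^+ 2 + b * x.1%:R) / P x.1) *
                            (q (h * x.2%:R ^+ 2 + c * x.2%:R) / P x.2)) =
  qpoch_inf (- q (h + b)) Q * qpoch_inf (- q (h + c)) Q.
Proof.
by rewrite -!eulerE // -(Sum_mul (eulerq_summable b) (eulerq_summable c)).
Qed.

Lemma euler_mul_summable b c :
  abs_summable (fun x : nat * nat => (q (h * x.1%:R ^+ 2 + b * x.1%:R) / P x.1) *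
                            (q (h * x.2%:R ^+ 2 + c * x.2%:R) / P x.2)).
Proof. exact: (abs_summable_mul (eulerq_summable b) (eulerq_summable c)). Qed.

(** The two Euler expansions are multiplied and grouped by the difference n of
    the summation indices; the coefficient of n is a Durfee rectangle sum and
    does not depend on n. *)
Lemma jacobi_triple_product b :
  J * (qpoch_inf (- q (h + b)) Q * qpoch_inf (- q (h - b)) Q) =
  Sum (fun n : int => q (h * n%:~R ^+ 2 + b * n%:~R)).
Proof.
rewrite -euler_mul (Sum_bij pair_of_diffK diff_of_pairK); last exact: euler_mul_summable.
have e (x : int * nat) :
    (q (h * (pair_of_diff x).1%:R ^+ 2 + b * (pair_of_diff x).1%:R) / P (pair_of_diff x).1) *
    (q (h * (pair_of_diff x).2%:R ^+ 2 + - b * (pair_of_diff x).2%:R) / P (pair_of_diff x).2) =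
    q (h * x.1%:~R ^+ 2 + b * x.1%:~R) *
    (q (2 * h * (x.2%:R ^+ 2 + `|x.1|%N%:R * x.2%:R)) / (P x.2 * P (x.2 + `|x.1|)%N)).
  rewrite mulf_div -qpowD mulrA -qpowD.
  case: x => [[n|n] m] /=; rewrite ?NegzE ?abszN /= ?absz_nat.
    rewrite (mulrC (P m)); congr (q _ / _); rewrite natrD pmulrn; ring.
  congr (q _ / _); rewrite natrD rmorphN /= -pmulrn; ring.
have s := abs_summable_inj (can_inj pair_of_diffK) (euler_mul_summable b (- b)).
rewrite (eq_Sum e) Sum_prod; last exact: eq_abs_summable e s.
rewrite -SumZ; last first.
  exact: abs_summable_Sum (eq_abs_summable e s).
apply: eq_Sum => n /=; rewrite SumZ; last exact: durfee_summable.
by rewrite -durfee_Sum durfee_const // mulrCA qpoch_inf_durfee // mulr1.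
Qed.

(** The part of the triple sum with |j - i| = a, summed over k (first component)
    and min(i, j) (second component). *)
Definition diff_coef (g : rat) (a : nat) : C :=
  Sum (fun x : nat * nat =>
    q (h * (2 * x.2%:R ^+ 2 + 2 * x.2%:R * a%:R + a%:R ^+ 2 + x.1%:R ^+ 2
            - x.1%:R * (2 * x.2%:R + a%:R)) + g * x.1%:R)
    / (P x.2 * P (x.2 + a) * P x.1)).

(** The sum over min(i, j) is [durfee_below]; the q-binomial sum then turns the sum
    over k into a Cauchy product of two Euler expansions. *)
Lemma diff_coef_nat g a :
  abs_summable (fun x : nat * nat =>
    q (h * (2 * x.2%:R ^+ 2 + 2 * x.2%:R * a%:R + a%:R ^+ 2 + x.1%:R ^+ 2
            - x.1%:R * (2 * x.2%:R + a%:R)) + g * x.1%:R)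
    / (P x.2 * P (x.2 + a) * P x.1)) ->
  J * diff_coef g a = q (h * a%:R ^+ 2) *
    (qpoch_inf (- q (h + (h * a%:R + g))) Q * qpoch_inf (- q (h + (g - h * a%:R))) Q).
Proof.
move=> sF; rewrite -euler_mul Sum_cauchy; last exact: euler_mul_summable.
rewrite /diff_coef Sum_prod // -(SumZ _ (abs_summable_Sum sF)).
rewrite -(SumZ _ (abs_summable_diag (euler_mul_summable _ _))).
apply: eq_Sum => k /=.
have e m : q (h * (2 * m%:R ^+ 2 + 2 * m%:R * a%:R + a%:R ^+ 2 + k%:R ^+ 2
    - k%:R * (2 * m%:R + a%:R)) + g * k%:R) / (P m * P (m + a) * P k) =
  q (h * (a%:R ^+ 2 + k%:R ^+ 2 - k%:R * a%:R) + g * k%:R) / P k *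
  (q (2 * h * (m%:R ^+ 2 + (a%:R - k%:R) * m%:R)) / (P m * P (m + a))).
  rewrite mulf_div -qpowD (mulrC (P k)); congr (q _ / _); ring.
rewrite (eq_Sum e) SumZ; last exact: durfee_summable.
rewrite -durfee_Sum mulrCA durfee_below // mulrA divfK ?qpochQ_neq0 //.
rewrite /qbinsum !mulr_sumr; apply: eq_bigr => -[s /=]; rewrite ltnS => sk _.
rewrite mulf_div -qpowD !(mulrA (q _)) -!qpowD; congr (q _ / _).
rewrite -{1 2 3}(subnKC sk) natrD; ring.
Qed.

End Theta.

Opaque diff_coef.

(** * Triple sums grouped by the difference of two indices *)

Definition triple_of_diff (x : int * (nat * nat)) : nat * nat * nat :=
  ((pair_of_diff (x.1, x.2.2)).2, (pair_of_diff (x.1, x.2.2)).1, x.2.1).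

Definition diff_of_triple (t : nat * nat * nat) : int * (nat * nat) :=
  ((diff_of_pair (t.1.2, t.1.1)).1, (t.2, (diff_of_pair (t.1.2, t.1.1)).2)).

Lemma triple_of_diffK : cancel triple_of_diff diff_of_triple.
Proof.
move=> [N [k m]]; rewrite /triple_of_diff /diff_of_triple /=.
by have := pair_of_diffK (N, m); case: (pair_of_diff (N, m)) => s t; rewrite /diff_of_pair /= => -[-> ->].
Qed.

Lemma diff_of_tripleK : cancel diff_of_triple triple_of_diff.
Proof.
move=> [[i j] k]; rewrite /triple_of_diff /diff_of_triple /=.
by have := diff_of_pairK (j, i); rewrite /diff_of_pair /= => ->.
Qed.

Lemma triple_of_diffE x : (triple_of_diff x).1.2%:Z - (triple_of_diff x).1.1%:Z = x.1.
Proof. by case: x => [[n|n] [k m]]; rewrite /triple_of_diff /pair_of_diff /= ?NegzE; lia. Qed.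

Section Triple.
Variables (R : realType) (tau : R[i]) (h : rat).
Hypothesis htau : 0 < complex.Im tau.
Hypothesis h0 : 0 < h.
Local Notation C := R[i].
Local Notation q := (qpow tau).
Local Notation Q := (qpow tau (2 * h)).
Local Notation P := (qpoch Q Q).
Local Notation J := (qpoch_inf Q Q).
Local Notation t0 := (2 * pi * complex.Im tau).

Lemma gauss3_summable (d a b c : R) : 0 < d ->
  abs_summable (fun t : nat * nat * nat =>
    (expR (- (d * t.1.1%:R ^+ 2 + a * t.1.1%:R) + - (d * t.1.2%:R ^+ 2 + b * t.1.2%:R)
      + - (d * t.2%:R ^+ 2 + c * t.2%:R)))%:C).
Proof.
move=> d0; have := abs_summable_mul (abs_summable_mul
  (gauss_summable_nat a d0) (gauss_summable_nat b d0)) (gauss_summable_nat c d0).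
by apply: eq_abs_summable => t; rewrite !expRD !rmorphM.
Qed.

Definition triple_term (a b c : rat) (t : nat * nat * nat) : C :=
  q (h * (t.1.1%:R ^+ 2 + t.1.2%:R ^+ 2 + t.2%:R ^+ 2 - t.1.1%:R * t.2%:R - t.1.2%:R * t.2%:R)
     + a * t.1.1%:R + b * t.1.2%:R + c * t.2%:R) / (P t.1.1 * P t.1.2 * P t.2).

(** The quadratic form of the triple sums is positive definite: it exceeds a
    quarter of the sum of squares. *)
Lemma D3_form_ge (d x y z : R) : 0 < d ->
  d / 4 * x ^+ 2 + d / 4 * y ^+ 2 + d / 4 * z ^+ 2 <=
  d * (x ^+ 2 + y ^+ 2 + z ^+ 2 - x * z - y * z).
Proof.
move=> d0; rewrite -subr_ge0.
rewrite (_ : _ - _ = d * (3 / 4 * (x - 2 / 3 * z) ^+ 2 + 3 / 4 * (y - 2 / 3 * z) ^+ 2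
   + 1 / 12 * z ^+ 2)); last by field.
by rewrite mulr_ge0 ?(ltW d0) // !addr_ge0 // mulr_ge0 ?sqr_ge0 //; lra.
Qed.

Lemma triple_term_le (a b c : rat) : exists2 K : R, 0 < K & forall t,
  normc (triple_term a b c t) <= K * expR (
    - (t0 * ratr h / 4 * t.1.1%:R ^+ 2 + t0 * ratr a * t.1.1%:R)
    + - (t0 * ratr h / 4 * t.1.2%:R ^+ 2 + t0 * ratr b * t.1.2%:R)
    + - (t0 * ratr h / 4 * t.2%:R ^+ 2 + t0 * ratr c * t.2%:R)).
Proof.
have [K K0 HK] := inv_qpochQ_bounded htau h0.
exists (K * K * K); first by rewrite !mulr_gt0.
move=> [[i j] k]; rewrite /triple_term /= normcM mulrC !invfM !normcM.
apply: ler_pM; rewrite ?mulr_ge0 ?normc_ge0 //.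
  by do 2 (apply: ler_pM; rewrite ?mulr_ge0 ?normc_ge0 //).
rewrite normc_qpow ler_expR.
have th : 0 < t0 * ratr h by rewrite mulr_gt0 ?im_gt0 ?ltr0q.
have := D3_form_ge i%:R j%:R k%:R th.
rewrite !(rmorphD, rmorphM, rmorphB, rmorphXn) /= !ratr_nat.
rewrite !(rmorphN, rmorphM) /= !ratr_nat; lra.
Qed.

Lemma triple_term_summable (a b c : rat) : abs_summable (triple_term a b c).
Proof.
have [K _ HK] := triple_term_le a b c.
have d0 : 0 < t0 * ratr h / 4 :> R.
  by rewrite divr_gt0 // mulr_gt0 ?im_gt0 ?ltr0q.
have := gauss3_summable (t0 * ratr a)
  (t0 * ratr b) (t0 * ratr c) d0.
apply: (abs_summable_le (c := K)) => t.
rewrite normc_real (ger0_norm (expR_ge0 _)); exact: HK.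
Qed.

(** The weight |j - i| <= exp(i + j) is absorbed into the linear part of the
    Gaussian majorant. *)
Lemma triple_term_summable_weight (a b c : rat) :
  abs_summable (fun t => (t.1.2%:Z - t.1.1%:Z)%:~R * triple_term a b c t).
Proof.
have [K K0 HK] := triple_term_le a b c.
have d0 : 0 < t0 * ratr h / 4 :> R.
  by rewrite divr_gt0 // mulr_gt0 ?im_gt0 ?ltr0q.
have := gauss3_summable (t0 * ratr a - 1)
  (t0 * ratr b - 1) (t0 * ratr c) d0.
apply: (abs_summable_le (c := K)) => -[[i j] k] /=.
rewrite normc_real (ger0_norm (expR_ge0 _)) normcM.
apply: le_trans (ler_wpM2l (normc_ge0 _) (HK _)) _; rewrite mulrCA.
rewrite ler_wpM2l ?(ltW K0) //=.
apply: le_trans (_ : expR (i%:R + j%:R) * _ <= _).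
  apply: ler_wpM2r; first exact: expR_ge0.
  have -> : ((j%:Z - i%:Z)%:~R : C) = (j%:R - i%:R)%:C by rewrite intrB -!pmulrn rmorphB /= !rmorph_nat.
  rewrite normc_real; apply: le_trans (ler_normB _ _) _; rewrite !normr_nat.
  by apply: le_trans (expR_ge1Dx _); lra.
by rewrite -expRD ler_expR; lra.
Qed.

Lemma triple_term_of_diff g (x : int * (nat * nat)) :
  triple_term 0 0 g (triple_of_diff x) =
    q (h * (2 * x.2.2%:R ^+ 2 + 2 * x.2.2%:R * `|x.1|%N%:R + `|x.1|%N%:R ^+ 2 + x.2.1%:R ^+ 2
            - x.2.1%:R * (2 * x.2.2%:R + `|x.1|%N%:R)) + g * x.2.1%:R)
    / (P x.2.2 * P (x.2.2 + `|x.1|%N) * P x.2.1).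
Proof.
case: x => [[n|n] [k m]]; rewrite /triple_term /triple_of_diff /pair_of_diff /= ?NegzE ?abszN ?absz_nat.
  by congr (q _ / _); rewrite natrD; ring.
by rewrite (mulrC (P _) (P m)); congr (q _ / _); rewrite natrD; ring.
Qed.

Lemma diff_coef_summable g (N : int) : abs_summable (fun x : nat * nat =>
    q (h * (2 * x.2%:R ^+ 2 + 2 * x.2%:R * `|N|%N%:R + `|N|%N%:R ^+ 2 + x.1%:R ^+ 2
            - x.1%:R * (2 * x.2%:R + `|N|%N%:R)) + g * x.1%:R)
    / (P x.2 * P (x.2 + `|N|%N) * P x.1)).
Proof.
have inj : injective (fun x : nat * nat => triple_of_diff (N, x)).
  by move=> x y /(can_inj triple_of_diffK) [].
apply: eq_abs_summable (abs_summable_inj inj (triple_term_summable 0 0 g)) => x.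
exact: triple_term_of_diff.
Qed.

Lemma balanced_summable (w : int -> C) g :
  abs_summable (fun t => w (t.1.2%:Z - t.1.1%:Z) * triple_term 0 0 g t) ->
  abs_summable (fun N => w N * diff_coef tau h g `|N|%N).
Proof.
move=> s; have s' := abs_summable_Sum (abs_summable_inj (can_inj triple_of_diffK) s).
apply: eq_abs_summable s' => N.
rewrite -(SumZ (w N) (diff_coef_summable g N)); apply: eq_Sum => x.
by rewrite /comp triple_term_of_diff triple_of_diffE.
Qed.

(** Grouping by N = j - i: a weight that depends only on N factors out. *)
Lemma balanced_sum (w : int -> C) g :
  abs_summable (fun t => w (t.1.2%:Z - t.1.1%:Z) * triple_term 0 0 g t) ->
  Sum (fun t => w (t.1.2%:Z - t.1.1%:Z) * triple_term 0 0 g t) =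
  Sum (fun N => w N * diff_coef tau h g `|N|%N).
Proof.
move=> s; rewrite (Sum_bij triple_of_diffK diff_of_tripleK) // Sum_prod; last first.
  exact: (abs_summable_inj (can_inj triple_of_diffK) s).
apply: eq_Sum => N.
rewrite -(SumZ (w N) (diff_coef_summable g N)); apply: eq_Sum => x.
by rewrite /comp triple_term_of_diff triple_of_diffE.
Qed.

(** The right-hand side is invariant under N |-> -N, which exchanges its two
    products. *)
Lemma diff_coef_int g (N : int) : J * diff_coef tau h g `|N|%N = q (h * N%:~R ^+ 2) *
  (qpoch_inf (- q (h + (h * N%:~R + g))) Q * qpoch_inf (- q (h + (g - h * N%:~R))) Q).
Proof.
rewrite (diff_coef_nat htau h0 (diff_coef_summable g N)).
case: N => n; rewrite ?NegzE ?abszN ?absz_nat; first by rewrite -pmulrn.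
rewrite mulrNz -pmulrn sqrrN; move: (n.+1%:R : rat) => m.
have -> : h + (h * - m + g) = h + (g - h * m) by ring.
have -> : h + (g - h * - m) = h + (h * m + g) by ring.
by rewrite [X in _ = _ * X]mulrC.
Qed.

Lemma diff_coef_theta0 (N : int) : J ^+ 2 * diff_coef tau h 0 `|N|%N =
  Sum (fun n : int => q (h * (N%:~R ^+ 2 + N%:~R * n%:~R + n%:~R ^+ 2))).
Proof.
rewrite expr2 -mulrA diff_coef_int mulrCA addr0 (addrC 0) addr0.
rewrite (jacobi_triple_product htau h0 (h * N%:~R)) -SumZ; last exact: qint_summable.
by apply: eq_Sum => n; rewrite -qpowD; congr q; ring.
Qed.

(** For g = -h the arguments of the two products no longer multiply to Q, so one
    factor is split off before Jacobi's triple product applies. *)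
Lemma diff_coef_thetaN (N : int) : J ^+ 2 * diff_coef tau h (- h) `|N|%N =
  (1 + q (- h * N%:~R)) *
  Sum (fun n : int => q (h * (N%:~R ^+ 2 + N%:~R * n%:~R + n%:~R ^+ 2 - n%:~R))).
Proof.
rewrite expr2 -mulrA diff_coef_int mulrCA.
have -> : h + (- h - h * N%:~R) = - h * N%:~R by ring.
rewrite (qpoch_inf_shift htau h0 (- q (- h * N%:~R)) 1) qpochS qpoch0 expr0 expr1 mul1r mulr1 opprK.
rewrite (mulNr (q _)) -qpowD (_ : - h * N%:~R + 2 * h = h - (h * N%:~R - h)); last by ring.
set b := h * N%:~R - h.
have e x y z w v : x * (y * (z * (w * v))) = w * (x * (y * (z * v))) :> C by ring.
rewrite e.
rewrite (jacobi_triple_product htau h0 b) -(SumZ (q _)); last exact: qint_summable.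
by congr (_ * _); apply: eq_Sum => n; rewrite -qpowD /b; congr q; ring.
Qed.

(** For g = h one factor is missing; supplying it multiplies the coefficient by
    1 + q^(hN). *)
Lemma diff_coef_thetaP (N : int) : (1 + q (h * N%:~R)) * (J ^+ 2 * diff_coef tau h h `|N|%N) =
  Sum (fun n : int => q (h * (N%:~R ^+ 2 + N%:~R * n%:~R + n%:~R ^+ 2 - n%:~R))).
Proof.
rewrite expr2 -mulrA diff_coef_int.
pose b := h * N%:~R - h.
have -> : h + (h - h * N%:~R) = h - b by rewrite /b; ring.
have e1 : h * N%:~R = h + b by rewrite /b; ring.
have e2 : h + (h * N%:~R + h) = h + b + 2 * h by rewrite /b; ring.
have e : (1 + q (h * N%:~R)) * qpoch_inf (- q (h + (h * N%:~R + h))) Q = qpoch_inf (- q (h + b)) Q.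
  rewrite e2 e1 (qpoch_inf_shift htau h0 (- q (h + b)) 1) qpochS qpoch0.
  by rewrite expr0 expr1 mul1r mulr1 opprK (mulNr (q _)) -qpowD.
transitivity (q (h * N%:~R ^+ 2) * (J * (qpoch_inf (- q (h + b)) Q * qpoch_inf (- q (h - b)) Q))).
  have e' x y z w v : x * (y * (z * (w * v))) = z * (y * (x * w * v)) :> C by ring.
  by rewrite -e e'.
rewrite (jacobi_triple_product htau h0 b) -SumZ; last exact: qint_summable.
by apply: eq_Sum => n; rewrite -qpowD /b; congr q; ring.
Qed.

(** Theta series of the hexagonal lattice, with a linear term. *)
Definition hexsum (a b : rat) : C := Sum (fun x : int * int =>
  q (h * (x.1%:~R ^+ 2 + x.1%:~R * x.2%:~R + x.2%:~R ^+ 2) + a * x.1%:~R + b * x.2%:~R)).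

(** y^2 + yz + z^2 is half of y^2 + z^2 + (y + z)^2. *)
Lemma hex_le (a b : rat) (x : int * int) :
  normc (q (h * (x.1%:~R ^+ 2 + x.1%:~R * x.2%:~R + x.2%:~R ^+ 2) + a * x.1%:~R + b * x.2%:~R))
  <= expR (- (t0 * ratr h / 2 * x.1%:~R ^+ 2 + t0 * ratr a * x.1%:~R)) *
     expR (- (t0 * ratr h / 2 * x.2%:~R ^+ 2 + t0 * ratr b * x.2%:~R)).
Proof.
rewrite normc_qpow -expRD ler_expR.
have th : 0 < t0 * ratr h by rewrite mulr_gt0 ?im_gt0 ?ltr0q.
rewrite !(rmorphD, rmorphM, rmorphXn) /= !ratr_int.
move: (x.1%:~R : R) (x.2%:~R : R) => y z.
have : 0 <= t0 * ratr h * ((y + z) ^+ 2) by rewrite mulr_ge0 ?sqr_ge0 ?(ltW th).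
nra.
Qed.

Lemma hex_summable (a b : rat) : abs_summable (fun x : int * int =>
  q (h * (x.1%:~R ^+ 2 + x.1%:~R * x.2%:~R + x.2%:~R ^+ 2) + a * x.1%:~R + b * x.2%:~R)).
Proof.
have d0 : 0 < t0 * ratr h / 2 :> R.
  by rewrite divr_gt0 // mulr_gt0 ?im_gt0 ?ltr0q.
have := abs_summable_mul (gauss_summable_int (t0 * ratr a) d0)
  (gauss_summable_int (t0 * ratr b) d0).
apply: (abs_summable_le (c := 1)) => x; rewrite mul1r normcM !normc_real.
by rewrite !(ger0_norm (expR_ge0 _)); exact: hex_le.
Qed.

(** The weight |y| is at most exp(y) + exp(-y), which moves the linear coefficient
    by one in either direction. *)
Lemma hex_summable_weight (a b : rat) : abs_summable (fun x : int * int =>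
  x.1%:~R *
  q (h * (x.1%:~R ^+ 2 + x.1%:~R * x.2%:~R + x.2%:~R ^+ 2) + a * x.1%:~R + b * x.2%:~R)).
Proof.
have d0 : 0 < t0 * ratr h / 2 :> R.
  by rewrite divr_gt0 // mulr_gt0 ?im_gt0 ?ltr0q.
pose al := t0 * ratr a : R.
(* The terms exp(y) and exp(-y) of the bound on the weight, one Gaussian each. *)
have s1 := abs_summableD (gauss_summable_int (al - 1) d0) (gauss_summable_int (al + 1) d0).
have := abs_summable_mul s1 (gauss_summable_int (t0 * ratr b) d0).
apply: (abs_summable_le (c := 1)) => x; rewrite mul1r !normcM -rmorphD !normc_real.
rewrite !ger0_norm ?addr_ge0 ?expR_ge0 //.
apply: le_trans (ler_wpM2l (normc_ge0 _) (hex_le _ _ _)) _.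
rewrite mulrA; apply: ler_wpM2r; first exact: expR_ge0.
have -> : (x.1%:~R : C) = (x.1%:~R : R)%:C by rewrite rmorph_int.
rewrite normc_real -/al; set y := (x.1%:~R : R).
set d := _ / 2.
have -> : expR (- (d * y ^+ 2 + (al - 1) * y)) + expR (- (d * y ^+ 2 + (al + 1) * y)) =
  (expR y + expR (- y)) * expR (- (d * y ^+ 2 + al * y)).
  by rewrite (mulrDl (expR y)) -!expRD; congr (expR _ + expR _); ring.
apply: ler_wpM2r; first exact: expR_ge0.
have h1 := expR_ge1Dx y; have h2 := expR_ge1Dx (- y).
have h3 := expR_ge0 y; have h4 := expR_ge0 (- y).
by rewrite ler_norml; apply/andP; split; lra.
Qed.

End Triple.

Opaque hexsum.

(** * Dissections of infinite products and of lattice sums *)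

Section Dissections.
Variables (R : realType) (tau : R[i]).
Hypothesis htau : 0 < complex.Im tau.
Local Notation C := R[i].
Local Notation q := (qpow tau).

Lemma qpoch_inf_cvg_pos s x : 0 < s ->
  ((fun n => (qpoch x (q s) n : C^o)) @ \oo --> (qpoch_inf x (q s) : C^o))%classic.
Proof.
move=> s0; have h0 : 0 < s / 2 by rewrite divr_gt0.
have -> : s = 2 * (s / 2) by field.
exact: qpoch_inf_cvg.
Qed.

Lemma qpoch_inf_neq0 s : 0 < s -> qpoch_inf (q s) (q s) != 0.
Proof.
move=> s0; have h0 : 0 < s / 2 by rewrite divr_gt0.
have -> : s = 2 * (s / 2) by field.
exact: qpoch_infQ_neq0.
Qed.

Lemma qpoch_inf_recl s x : 0 < s -> qpoch_inf x (q s) = (1 - x) * qpoch_inf (x * q s) (q s).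
Proof.
move=> s0; have h0 : 0 < s / 2 by rewrite divr_gt0.
have -> : s = 2 * (s / 2) by field.
by rewrite (qpoch_inf_shift htau h0 x 1) qpochS qpoch0 expr0 expr1 mul1r mulr1.
Qed.

Lemma cvg_complex_subseq (u : nat -> C) (l : C) m : (0 < m)%N ->
  ((fun n => (u n : C^o)) @ \oo --> (l : C^o))%classic ->
  ((fun n => (u (m * n)%N : C^o)) @ \oo --> (l : C^o))%classic.
Proof.
move=> m0 /cvg_normcP H; apply/cvg_normcP => e /H[N HN]; exists N => n Nn; apply: HN.
by apply: leq_trans Nn _; rewrite leq_pmull.
Qed.

Lemma cvg_complex_prod m (u : nat -> nat -> C) (l : nat -> C) :
  (forall r, ((fun n => (u r n : C^o)) @ \oo --> (l r : C^o))%classic) ->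
  ((fun n => (\prod_(r < m) u r n : C^o)) @ \oo --> (\prod_(r < m) l r : C^o))%classic.
Proof.
move=> H; elim: m => [|m IH].
  apply/cvg_normcP => e e0; exists 0%N => n _.
  by rewrite !big_ord0 subrr normc0.
rewrite big_ord_recr /=.
rewrite (_ : (fun n => _) = (fun n => (\prod_(r < m) u r n) * u m n : C^o)); last first.
  by apply/funext => n; rewrite big_ord_recr.
by apply: cvgM; [exact: IH|exact: H].
Qed.

(** The factors are sorted by the residue of their index modulo m. *)
Lemma qpoch_section (x p : C) m n :
  qpoch x p (m * n) = \prod_(r < m) qpoch (x * p ^+ r) (p ^+ m) n.
Proof.
elim: n => [|n IH].
  by rewrite muln0 qpoch0 big1 // => r _; rewrite qpoch0.
rewrite mulnSr; under [RHS]eq_bigr do rewrite qpochS.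
rewrite big_split /= -IH.
suff H k : qpoch x p (m * n + k) =
    qpoch x p (m * n) * \prod_(r < k) (1 - x * p ^+ r * (p ^+ m) ^+ n) by exact: H.
elim: k => [|k IHk]; first by rewrite addn0 big_ord0 mulr1.
rewrite addnS qpochS IHk big_ord_recr /= mulrA; congr (_ * _ * (1 - _)).
by rewrite -mulrA -exprM -exprD addnC.
Qed.

Lemma qpoch_inf_multisection m s x : (0 < m)%N -> 0 < s ->
  qpoch_inf x (q s) = \prod_(r < m) qpoch_inf (x * q (r%:R * s)) (q (m%:R * s)).
Proof.
move=> m0 s0; have := cvg_complex_subseq m0 (@qpoch_inf_cvg_pos s x s0).
move=> c1; apply: (cvg_complex_unique c1).
have c2 := @cvg_complex_prod m (fun r n => qpoch (x * q (r%:R * s)) (q (m%:R * s)) n)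
  (fun r => qpoch_inf (x * q (r%:R * s)) (q (m%:R * s))).
have ms0 : 0 < m%:R * s by rewrite mulr_gt0 // ltr0n.
rewrite (_ : (fun n => _) = (fun n => \prod_(r < m) qpoch (x * q (r%:R * s)) (q (m%:R * s)) n)).
  by apply: c2 => r; exact: qpoch_inf_cvg_pos.
apply/funext => n; rewrite qpoch_section qpowX; apply: eq_bigr => r _.
by rewrite qpowX.
Qed.

Lemma qpoch_sq (x p : C) n : qpoch x p n * qpoch (- x) p n = qpoch (x ^+ 2) (p ^+ 2) n.
Proof.
elim: n => [|n IH]; first by rewrite !qpoch0 mulr1.
rewrite !qpochS -IH -exprM mulnC exprM.
by move: (qpoch _ _ _) (qpoch _ _ _) (p ^+ n) => u v y; ring.
Qed.

Lemma qpoch_inf_sqr s x : 0 < s ->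
  qpoch_inf x (q s) * qpoch_inf (- x) (q s) = qpoch_inf (x ^+ 2) (q (2 * s)).
Proof.
move=> s0; have s20 : 0 < 2 * s by rewrite mulr_gt0.
have c : ((fun n => (qpoch x (q s) n * qpoch (- x) (q s) n : C^o)) @ \oo -->
   (qpoch_inf x (q s) * qpoch_inf (- x) (q s) : C^o))%classic.
  by apply: cvgM; exact: qpoch_inf_cvg_pos.
apply: (cvg_complex_unique c).
rewrite (_ : (fun n => _) = (fun n => qpoch (x ^+ 2) (q (2 * s)) n)); first exact: qpoch_inf_cvg_pos.
by apply/funext => n; rewrite qpoch_sq (qpowX _ s 2).
Qed.

(** Euclidean division by m + 1 in the first coordinate. *)
Lemma Sum_int_mod (T : choiceType) m (f : int * T -> C) : abs_summable f ->
  Sum f = \sum_(0 <= r < m.+1) Sum (fun x : int * T => f (x.1 * m.+1%:Z + r%:Z, x.2)).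
Proof.
move=> sf; rewrite big_mkord.
pose phi (x : 'I_m.+1 * (int * T)) : int * T := (x.2.1 * m.+1%:Z + x.1%:Z, x.2.2).
pose psi (y : int * T) : 'I_m.+1 * (int * T) :=
  (inord `|(y.1 %% m.+1%:Z)%Z|, ((y.1 %/ m.+1%:Z)%Z, y.2)).
have phiK : cancel phi psi.
  move=> [r [e x]]; rewrite /phi /psi /= modzMDl divzMDl // modz_small; last first.
    by rewrite /= ltz_nat ltn_ord.
  by rewrite divz_small ?addr0 ?inord_val //= ltz_nat ltn_ord.
have psiK : cancel psi phi.
  move=> [d x]; rewrite /phi /psi /= inordK; last first.
    by rewrite -ltz_nat gez0_abs ?modz_ge0 // ltz_pmod.
  by rewrite gez0_abs ?modz_ge0 // -divz_eq.
rewrite (Sum_bij phiK psiK) // Sum_prod; last exact: (abs_summable_inj (can_inj phiK) sf).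
rewrite (@Sum_seq _ _ _ (index_enum 'I_m.+1)) ?index_enum_uniq //.
by move=> r; rewrite mem_index_enum.
Qed.

(** Jacobi's triple product at b = h has the factor (-1;Q)_oo = 2 (-Q;Q)_oo, and
    (Q;Q)_oo (-Q;Q)_oo = (Q^2;Q^2)_oo. *)
Lemma psi_sum h : 0 < h ->
  qpoch_inf (q (2 * h)) (q (2 * h)) * Sum (fun n : int => q (h * n%:~R ^+ 2 + h * n%:~R)) =
  2 * qpoch_inf (q (4 * h)) (q (4 * h)) ^+ 2.
Proof.
move=> h0; have h20 : 0 < 2 * h by rewrite mulr_gt0.
rewrite -(jacobi_triple_product htau h0) subrr qpow0 (_ : h + h = 2 * h); last by ring.
rewrite (qpoch_inf_recl (- 1) h20) mulNr mul1r opprK.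
have := qpoch_inf_sqr (q (2 * h)) h20; rewrite qpowX (_ : 2 * (2 * h) = 4 * h); last by ring.
move=> <-; move: (qpoch_inf _ _) (qpoch_inf _ _) => x y; ring.
Qed.

End Dissections.

Transparent hexsum.

(** * The product formula for the cubic theta function *)

Section Cubic.
Variables (R : realType) (tau : R[i]).
Hypothesis htau : 0 < complex.Im tau.
Local Notation C := R[i].
Local Notation q := (qpow tau).

Definition theta (h b : rat) : C := Sum (fun n : int => q (h * n%:~R ^+ 2 + b * n%:~R)).

(** Affine bijections of Z^2 transport one quadratic exponent to another. *)
Lemma hexsum_reindex h a b (phi psi : int * int -> int * int) (f : int * int -> rat) :
  0 < h -> cancel phi psi -> cancel psi phi ->
  (forall x, f x = h * ((phi x).1%:~R ^+ 2 + (phi x).1%:~R * (phi x).2%:~R + (phi x).2%:~R ^+ 2)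
     + a * (phi x).1%:~R + b * (phi x).2%:~R) ->
  Sum (fun x => q (f x)) = hexsum tau h a b.
Proof.
move=> h0 c1 c2 e; rewrite /hexsum [RHS](Sum_bij c1 c2 (hex_summable htau h0 a b)).
by apply: eq_Sum => x; rewrite e.
Qed.

(** Needed to cancel this factor in [cubic_product]; nonvanishing of (-q;q)_oo
    follows from (q;q)_oo (-q;q)_oo = (q^2;q^2)_oo. *)
Lemma theta1_neq0 : theta (1 / 2) (- (1 / 2)) != 0.
Proof.
have h0 : (0 : rat) < 1 / 2 by [].
rewrite /theta -(jacobi_triple_product htau h0) (_ : 2 * (1 / 2) = 1) // (_ : 1 / 2 + - (1 / 2) = 0) //.
rewrite (_ : 1 / 2 - - (1 / 2) = 1) // qpow0.
rewrite (@qpoch_inf_recl _ _ htau 1 (- 1)) // mulN1r opprK.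
have J1 := @qpoch_inf_neq0 _ _ htau 1 ltr01.
have nz : qpoch_inf (- q 1) (q 1) != 0.
  apply/eqP => z; have := @qpoch_inf_sqr _ _ htau 1 (q 1) ltr01.
  rewrite z mulr0 qpowX mulr1 => /esym/eqP; apply/negP; exact: qpoch_inf_neq0.
have two : (1 + 1 : C) != 0 by rewrite (_ : 1 + 1 = 2%:R) // pnatr_eq0.
by rewrite !mulf_neq0.
Qed.

(** The exponent 3a(a-1)/2 + 3b(b-1)/2 + 3c(c-1)/2 + b + 2c of the product of the
    theta functions of base q^3 at 1, q and q^2. *)
Definition cubic_exp (a b c : int) : rat :=
  3 / 2 * (a%:~R ^+ 2 + b%:~R ^+ 2 + c%:~R ^+ 2)
  - 3 / 2 * a%:~R - 1 / 2 * b%:~R + 1 / 2 * c%:~R.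

Lemma cubic_summable :
  abs_summable (fun x : int * (int * int) => q (cubic_exp x.1 x.2.1 x.2.2)).
Proof.
have h0 : (0 : rat) < 3 / 2 by [].
have := abs_summable_mul (qint_summable htau (- (3 / 2)) h0)
  (abs_summable_mul (qint_summable htau (- (1 / 2)) h0) (qint_summable htau (1 / 2) h0)).
by apply: eq_abs_summable => x; rewrite -!qpowD; congr q; rewrite /cubic_exp; ring.
Qed.

Lemma cubic_sum : Sum (fun x : int * (int * int) => q (cubic_exp x.1 x.2.1 x.2.2)) =
  theta (3 / 2) (- (3 / 2)) * (theta (3 / 2) (- (1 / 2)) * theta (3 / 2) (1 / 2)).
Proof.
have h0 : (0 : rat) < 3 / 2 by [].
have s1 := qint_summable htau (- (3 / 2)) h0.
have s2 := qint_summable htau (- (1 / 2)) h0.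
have s3 := qint_summable htau (1 / 2) h0.
apply: etrans (etrans (Sum_mul s1 (abs_summable_mul s2 s3)) (congr1 _ (Sum_mul s2 s3))).
by apply: eq_Sum => x; rewrite -!qpowD; congr q; rewrite /cubic_exp; ring.
Qed.

Definition cubic_level (s : int) : C :=
  Sum (fun x : int * int => q (cubic_exp (s - x.1 - x.2) x.1 x.2)).

Lemma cubic_shift_summable :
  abs_summable (fun x : int * (int * int) => q (cubic_exp (x.1 - x.2.1 - x.2.2) x.2.1 x.2.2)).
Proof.
pose phi (x : int * (int * int)) := (x.1 - x.2.1 - x.2.2, x.2).
have inj : injective phi.
  move=> [s [b c]] [s' [b' c']] [] /= e1 e2 e3; congr pair; last by congr pair.
  lia.
exact: (abs_summable_inj inj cubic_summable).
Qed.

(** The substitution (a, b, c) |-> (c + 1, a, b) raises a + b + c by one, and the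
    exponent by a + b + c = s. *)
Lemma cubic_levelS s : cubic_level (s + 1) = q s%:~R * cubic_level s.
Proof.
have sm := abs_summable_prodP cubic_shift_summable s.
have sm' := abs_summable_prodP cubic_shift_summable (s + 1).
rewrite /cubic_level -(SumZ _ sm).
rewrite (@Sum_bij _ _ _ (fun x : int * int => (s - x.1 - x.2, x.1))
  (fun x : int * int => (x.2, s - x.2 - x.1)) _ _ _ sm') /=.
- apply: eq_Sum => x; rewrite -qpowD /cubic_exp; congr q.
  by rewrite !(rmorphB, rmorphD) /=; field.
- by move=> [b c] /=; congr pair; lia.
by move=> [b c] /=; congr pair; lia.
Qed.

(** Iterating the previous relation upwards and downwards, the levels follow the
    coefficients of the theta function of base q. *)
Lemma cubic_levelE s : cubic_level s = q (1 / 2 * s%:~R ^+ 2 - 1 / 2 * s%:~R) * cubic_level 0.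
Proof.
elim/int_ind: s => [|n IH|n IH].
- by rewrite (_ : 1 / 2 * _ - _ = 0) ?qpow0 ?mul1r //; field.
- rewrite -addn1 PoszD cubic_levelS IH (mulrA (q _)) -qpowD; congr (q _ * _).
  by rewrite rmorphD /=; field.
apply: (mulfI (qpow_neq0 tau (- n.+1%:Z)%:~R)).
rewrite -cubic_levelS (_ : - n.+1%:Z + 1 = - n%:Z); last lia.
rewrite IH (mulrA (q _)) -qpowD; congr (q _ * _).
by rewrite !mulrNz -!pmulrn -natr1; field.
Qed.

Lemma cubic_level0 : cubic_level 0 = hexsum tau 3 1 2.
Proof.
apply: eq_Sum => x; congr q; rewrite /cubic_exp !(rmorphB, rmorphN, rmorph0) /=.
by field.
Qed.

Lemma cubic_theta_product : theta (3 / 2) (- (3 / 2)) *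
    (theta (3 / 2) (- (1 / 2)) * theta (3 / 2) (1 / 2)) =
  theta (1 / 2) (- (1 / 2)) * hexsum tau 3 1 2.
Proof.
rewrite -cubic_level0; apply: etrans (esym cubic_sum) _.
rewrite (@Sum_bij _ _ _ (fun x : int * (int * int) => (x.1 - x.2.1 - x.2.2, x.2))
  (fun x : int * (int * int) => (x.1 + x.2.1 + x.2.2, x.2)) _ _ _ cubic_summable); last 2 first.
- by move=> [s [b c]] /=; congr pair; lia.
- by move=> [s [b c]] /=; congr pair; lia.
rewrite Sum_prod; last exact: cubic_shift_summable.
rewrite mulrC -SumZ; last by apply: qint_summable.
by apply: eq_Sum => s; rewrite mulrC; have := cubic_levelE s; rewrite mulNr.
Qed.

(** The extra equations let numerical parameters be given in reduced form. *)
Lemma theta_product (h b u v s : rat) : 0 < h -> s = 2 * h -> u = h + b -> v = h - b ->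
  theta h b = qpoch_inf (q s) (q s) * (qpoch_inf (- q u) (q s) * qpoch_inf (- q v) (q s)).
Proof. by move=> h_gt0 -> -> ->; rewrite /theta -(jacobi_triple_product htau h_gt0). Qed.

Opaque theta hexsum.

(** The products of the three theta functions of base q^3 interlace into those of
    the theta function of base q, so that its nonzero value cancels in
    [cubic_theta_product]. *)
Lemma cubic_product : qpoch_inf (q 1) (q 1) * hexsum tau 3 1 2 =
  qpoch_inf (q 3) (q 3) ^+ 3.
Proof.
have h0 : (0 : rat) < 3 / 2 by [].
have h1 : (0 : rat) < 1 / 2 by [].
have e1 := @theta_product (3 / 2) (- (3 / 2)) 0 3 3 h0 erefl erefl erefl.
have e2 := @theta_product (3 / 2) (- (1 / 2)) 1 2 3 h0 erefl erefl erefl.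
have e3 := @theta_product (3 / 2) (1 / 2) 2 1 3 h0 erefl erefl erefl.
have e4 := @theta_product (1 / 2) (- (1 / 2)) 0 1 1 h1 erefl erefl erefl.
have s1 (r u v : rat) : u = r + 1 -> v = r + 2 -> qpoch_inf (- q r) (q 1) =
    qpoch_inf (- q r) (q 3) * (qpoch_inf (- q u) (q 3) * qpoch_inf (- q v) (q 3)).
  move=> -> ->.
  have f (n : nat) : - q r * q (n%:R * 1) = - q (r + n%:R).
    by rewrite mulr1 (mulNr (q r)) -qpowD.
  have r0 : r + 0%:R = r by exact: addr0.
  rewrite (@qpoch_inf_multisection _ _ htau 3 1 (- q r) isT ltr01).
  rewrite -(big_mkord xpredT (fun i => qpoch_inf (- q r * q (i%:R * 1)) (q (3%:R * 1)))).
  do 3 (rewrite big_ltn; last by []); rewrite big_geq; last by [].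
  rewrite !f r0 (mulr1 (3%:R : rat)).
  move: (qpoch_inf (- q r) _) (qpoch_inf (- q (r + 1)) _) (qpoch_inf (- q (r + 2)) _) => x y z.
  by rewrite mulr1.
have s2 := s1 0 1 2 erefl erefl; have s3 := s1 1 2 3 erefl erefl.
have nz := theta1_neq0; have := cubic_theta_product.
move: e1 e2 e3 e4 nz s2 s3; move: (hexsum _ _ _ _).
move: (theta (3 / 2) (- (3 / 2))) (theta (3 / 2) (- (1 / 2))) (theta (3 / 2) (1 / 2)).
move: (theta _ _) => t4 t1 t2 t3 hx.
move: (qpoch_inf (q 3) (q 3)) (qpoch_inf (q 1) (q 1)) => J3 J1.
move: (qpoch_inf (- q 0) (q 3)) (qpoch_inf (- q 1) (q 3)) (qpoch_inf (- q 2) (q 3)).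
move: (qpoch_inf (- q 3) (q 3)) (qpoch_inf (- q 0) (q 1)) (qpoch_inf (- q 1) (q 1)).
move=> b3 c0 c1 b0 b1 b2 e1 e2 e3 e4 nz s2 s3 e5.
by apply: (mulfI nz); rewrite mulrCA -e5 e1 e2 e3 e4 s2 s3; ring.
Qed.

End Cubic.

Transparent theta hexsum.

(** * Evaluation of hexagonal lattice sums *)

Section Lattice.
Variables (R : realType) (tau : R[i]).
Hypothesis htau : 0 < complex.Im tau.
Local Notation C := R[i].
Local Notation q := (qpow tau).

Ltac int_pair := by move=> [? ?] /=; congr pair; lia.
Ltac int_ring := move=> [? ?] /=; rewrite !(rmorphD, rmorphB, rmorphN, rmorphM, rmorph1) /=; by field.

Lemma diff_reindex_summable (f : int * int -> C) :
  abs_summable f -> abs_summable (fun x => f (x.1 + x.2, x.2)).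
Proof.
apply: (@abs_summable_inj _ _ _ (fun x : int * int => (x.1 + x.2, x.2))).
by move=> [a b] [c d] [] e1 e2; congr pair; lia.
Qed.

Lemma Sum_diff_mod m (f : int * int -> C) : abs_summable f ->
  Sum f = \sum_(0 <= r < m.+1) Sum (fun x : int * int => f (x.1 * m.+1%:Z + r%:Z + x.2, x.2)).
Proof.
move=> sf; rewrite (@Sum_bij _ _ _ (fun x : int * int => (x.1 + x.2, x.2))
  (fun x : int * int => (x.1 - x.2, x.2)) f _ _ sf); try int_pair.
exact: Sum_int_mod (diff_reindex_summable sf).
Qed.

(** The order-3 rotation (N, n) |-> (n - 1, -N - n) preserves
    N^2 + Nn + n^2 + N and lowers N - n by one modulo 3, so the three residue classes
    contribute equally; on the class 0 the substitution N = b + 2c, n = -2b - c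
    multiplies the form by 3. *)
Lemma hexsum_mod3 : hexsum tau 1 1 0 = 3 * hexsum tau 3 1 2.
Proof.
have h3 : (0 : rat) < 3 by [].
rewrite {1}/hexsum (Sum_diff_mod 2 (hex_summable htau ltr01 1 0)).
do 3 (rewrite big_ltn; last by []); rewrite big_geq; last by [].
(* The bijections for the classes 1 and 2 are that for the class 0 composed with
   one and two rotations. *)
have e0 := @hexsum_reindex _ _ htau 3 1 2 (fun x => (- x.2 - x.1, 2 * x.1 + x.2))
  (fun x => (x.1 + x.2, - 2 * x.1 - x.2))
  (fun x => 1 * ((x.1 * 3%:Z + 0%:Z + x.2)%:~R ^+ 2 + (x.1 * 3%:Z + 0%:Z + x.2)%:~R * x.2%:~R + x.2%:~R ^+ 2)
     + 1 * (x.1 * 3%:Z + 0%:Z + x.2)%:~R + 0 * x.2%:~R) h3 _ _ _.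
have e1 := @hexsum_reindex _ _ htau 3 1 2 (fun x => (x.2 + 2 * x.1 + 1, - x.1 - 1))
  (fun x => (- x.2 - 1, x.1 + 2 * x.2 + 1))
  (fun x => 1 * ((x.1 * 3%:Z + 1%:Z + x.2)%:~R ^+ 2 + (x.1 * 3%:Z + 1%:Z + x.2)%:~R * x.2%:~R + x.2%:~R ^+ 2)
     + 1 * (x.1 * 3%:Z + 1%:Z + x.2)%:~R + 0 * x.2%:~R) h3 _ _ _.
have e2 := @hexsum_reindex _ _ htau 3 1 2 (fun x => (- x.1 - 1, - x.2 - x.1 - 1))
  (fun x => (- x.1 - 1, x.1 - x.2))
  (fun x => 1 * ((x.1 * 3%:Z + 2%:Z + x.2)%:~R ^+ 2 + (x.1 * 3%:Z + 2%:Z + x.2)%:~R * x.2%:~R + x.2%:~R ^+ 2)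
     + 1 * (x.1 * 3%:Z + 2%:Z + x.2)%:~R + 0 * x.2%:~R) h3 _ _ _.
have {}e0 := e0 ltac:(int_pair) ltac:(int_pair) ltac:(int_ring).
have {}e1 := e1 ltac:(int_pair) ltac:(int_pair) ltac:(int_ring).
have {}e2 := e2 ltac:(int_pair) ltac:(int_pair) ltac:(int_ring).
apply: etrans (congr2 +%R e0 (congr2 +%R e1 (congr2 +%R e2 erefl))) _.
by move: (hexsum _ _ _ _) => x; ring.
Qed.

Lemma hexsum_cubic : qpoch_inf (q 1) (q 1) * hexsum tau 1 1 0 = 3 * qpoch_inf (q 3) (q 3) ^+ 3.
Proof. by rewrite hexsum_mod3 mulrCA cubic_product. Qed.

Lemma hexsum_swap : hexsum tau 1 0 (- 1) = hexsum tau 1 1 0.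
Proof.
rewrite [LHS]/hexsum; apply: (@hexsum_reindex _ _ htau 1 1 0 (fun x => (- x.2, - x.1)) (fun x => (- x.2, - x.1))) => //.
- int_pair.
- int_pair.
int_ring.
Qed.

Lemma hexsum_rot : hexsum tau 1 (- 1) (- 1) = hexsum tau 1 1 0.
Proof.
rewrite [LHS]/hexsum; apply: (@hexsum_reindex _ _ htau 1 1 0
  (fun x => (- x.1 - x.2, x.2)) (fun x => (- x.1 - x.2, x.2))) => //.
- int_pair.
- int_pair.
int_ring.
Qed.

Definition hexterm (x : int * int) : C :=
  q (1 * (x.1%:~R ^+ 2 + x.1%:~R * x.2%:~R + x.2%:~R ^+ 2) + 1 * x.1%:~R + 0 * x.2%:~R).

(** In the coordinates N, n - 1, -N - n - 1 the exponent is symmetric, so the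
    three weighted sums coincide; the coordinates add up to -2. *)
Lemma hexsum_center : 3 * Sum (fun x => x.1%:~R * hexterm x) = - 2 * hexsum tau 1 1 0.
Proof.
have sW : abs_summable (fun x => x.1%:~R * hexterm x) := hex_summable_weight htau ltr01 1 0.
have sc : abs_summable hexterm := hex_summable htau ltr01 1 0.
have W1 : Sum (fun x => x.1%:~R * hexterm x) = Sum (fun x => (x.2 - 1)%:~R * hexterm x).
  rewrite (@Sum_bij _ _ _ (fun x : int * int => (x.2 - 1, x.1 + 1))
    (fun x : int * int => (x.2 - 1, x.1 + 1)) _ _ _ sW); try int_pair.
  apply: eq_Sum => x; congr (_ * q _); move: x; int_ring.
have W2 : Sum (fun x => x.1%:~R * hexterm x) = Sum (fun x => (- x.1 - x.2 - 1)%:~R * hexterm x).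
  rewrite (@Sum_bij _ _ _ (fun x : int * int => (- x.1 - x.2 - 1, x.2))
    (fun x : int * int => (- x.1 - x.2 - 1, x.2)) _ _ _ sW); try int_pair.
  apply: eq_Sum => x; congr (_ * q _); move: x; int_ring.
have s1 : abs_summable (fun x => (x.2 - 1)%:~R * hexterm x).
  apply: eq_abs_summable (abs_summable_inj (phi := fun x : int * int => (x.2 - 1, x.1 + 1)) _ sW).
    move=> x /=; congr (_ * q _); move: x; int_ring.
  by move=> [a b] [c d] [] e1 e2; congr pair; lia.
have s2 : abs_summable (fun x => (- x.1 - x.2 - 1)%:~R * hexterm x).
  apply: eq_abs_summable (abs_summable_inj (phi := fun x : int * int => (- x.1 - x.2 - 1, x.2)) _ sW).
    move=> x /=; congr (_ * q _); move: x; int_ring.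
  by move=> [a b] [c d] [] e1 e2; congr pair; lia.
have -> (y : C) : 3 * y = y + (y + y) by ring.
rewrite {2}W1 {2}W2 -(SumD s1 s2) -(SumD sW (abs_summableD s1 s2)).
rewrite /hexsum -(SumZ _ sc); apply: eq_Sum => x.
rewrite -!mulrDl; congr (_ * _); rewrite -!rmorphD /=.
by rewrite (_ : _ + _ = - 2) ?rmorphN //; ring.
Qed.

(** In terms of x = 2a + 1, y = 2b + 1 the product runs over the Eisenstein
    integers (x + y sqrt(-3))/2 of odd norm outside Z[sqrt(-3)].  They form two
    classes modulo 2, each a multiple by a unit of the class in Z[sqrt(-3)]: hence
    the split by the parity of a - b and the factor 2. *)
Lemma hexsum_psi : 2 * hexsum tau 2 (- 1) (- 2) = theta tau (1 / 2) (1 / 2) * theta tau (3 / 2) (3 / 2).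
Proof.
have h2 : (0 : rat) < 2 by [].
have h12 : (0 : rat) < 1 / 2 by [].
have h32 : (0 : rat) < 3 / 2 by [].
have sm := abs_summable_mul (qint_summable htau (1 / 2) h12) (qint_summable htau (3 / 2) h32).
apply: etrans (Sum_mul (qint_summable htau (1 / 2) h12) (qint_summable htau (3 / 2) h32)).
rewrite (Sum_diff_mod 1 sm).
do 2 (rewrite big_ltn; last by []); rewrite big_geq; last by [].
have e0 := @hexsum_reindex _ _ htau 2 (- 1) (- 2) (fun x => (x.1, - x.2 - x.1))
  (fun x => (x.1, - x.2 - x.1))
  (fun x => (1 / 2 * (x.1 * 2%:Z + 0%:Z + x.2)%:~R ^+ 2 + 1 / 2 * (x.1 * 2%:Z + 0%:Z + x.2)%:~R)
     + (3 / 2 * x.2%:~R ^+ 2 + 3 / 2 * x.2%:~R)) h2 _ _ _.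
have e1 := @hexsum_reindex _ _ htau 2 (- 1) (- 2) (fun x => (x.2 + x.1 + 1, - x.1))
  (fun x => (- x.2, x.1 + x.2 - 1))
  (fun x => (1 / 2 * (x.1 * 2%:Z + 1%:Z + x.2)%:~R ^+ 2 + 1 / 2 * (x.1 * 2%:Z + 1%:Z + x.2)%:~R)
     + (3 / 2 * x.2%:~R ^+ 2 + 3 / 2 * x.2%:~R)) h2 _ _ _.
have {}e0 := e0 ltac:(int_pair) ltac:(int_pair) ltac:(int_ring).
have {}e1 := e1 ltac:(int_pair) ltac:(int_pair) ltac:(int_ring).
apply/esym; apply: etrans (congr2 +%R (etrans _ e0) (etrans (addr0 _) (etrans _ e1))) _.
- by apply: eq_Sum => x; rewrite -qpowD.
- by apply: eq_Sum => x; rewrite -qpowD.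
by move: (hexsum _ _ _ _) => x; ring.
Qed.

(** With n even, n = -2m and N = x + m diagonalize the form as x^2 + 3m^2; with n
    odd, n = 1 - 2m and N = m - x do so up to linear terms. *)
Lemma hexsum_parity c : hexsum tau 2 c 0 =
  theta tau 2 c * theta tau 6 c + q 2 * (theta tau 2 (- 2 - c) * theta tau 6 (c - 6)).
Proof.
have h2 : (0 : rat) < 2 by [].
have h6 : (0 : rat) < 6 by [].
have sh := abs_summable_swap (hex_summable htau h2 c 0).
have m1 := Sum_mul (qint_summable htau c h2) (qint_summable htau c h6).
have m2 := Sum_mul (qint_summable htau (- 2 - c) h2) (qint_summable htau (c - 6) h6).
have s2 := abs_summable_mul (qint_summable htau (- 2 - c) h2) (qint_summable htau (c - 6) h6).
rewrite /hexsum (@Sum_bij _ _ _ (fun x : int * int => (x.2, x.1)) (fun x : int * int => (x.2, x.1)) _ _ _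
  (hex_summable htau h2 c 0)); try int_pair.
rewrite (Sum_int_mod 1 sh).
do 2 (rewrite big_ltn; last by []); rewrite big_geq; last by [].
(* The coordinates are now (e, N), with n = 2e + r. *)
have inj (r : int) : injective (fun x : int * int => (x.1 * 2%:Z + r, x.2)).
  by move=> [a b] [a' b'] [] e1 e2; congr pair; lia.
have sm r := abs_summable_inj (inj r) sh.
apply: etrans (congr2 +%R m1 (congr1 (fun z => q 2 * z) m2)).
apply: congr2; last apply: etrans (addr0 _) _.
  apply: etrans (@Sum_bij _ _ _ (fun x : int * int => (- x.2, x.1 + x.2))
    (fun x : int * int => (x.2 + x.1, - x.1)) _ _ _ (sm 0)) _; try int_pair.
  apply: eq_Sum => x; rewrite -qpowD; congr q; move: x; int_ring.
apply: etrans (@Sum_bij _ _ _ (fun x : int * int => (- x.2, x.2 - x.1))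
  (fun x : int * int => (- x.1 - x.2, - x.1)) _ _ _ (sm 1)) _; try int_pair.
rewrite -(SumZ _ s2); apply: eq_Sum => x; rewrite -!qpowD; congr q; move: x; int_ring.
Qed.

End Lattice.

Opaque theta.

(** * Triple sums as hexagonal lattice sums *)

Section TripleSums.
Variables (R : realType) (tau : R[i]) (h : rat).
Hypothesis htau : 0 < complex.Im tau.
Hypothesis h0 : 0 < h.
Local Notation C := R[i].
Local Notation q := (qpow tau).
Local Notation Q := (qpow tau (2 * h)).
Local Notation P := (qpoch Q Q).
Local Notation J := (qpoch_inf Q Q).
Local Notation T := (triple_term tau h).

Lemma triple_term_exp c g t :
  T (- c) c g t = q (c * (t.1.2%:Z - t.1.1%:Z)%:~R) * T 0 0 g t.
Proof.
rewrite /triple_term mulrA -qpowD; congr (q _ / _).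
rewrite rmorphB /= -!pmulrn; ring.
Qed.

Lemma balanced_exp_summable c g :
  abs_summable (fun N : int => q (c * N%:~R) * diff_coef tau h g `|N|%N).
Proof.
apply: (balanced_summable htau h0 (w := fun N => q (c * N%:~R))).
exact: eq_abs_summable (triple_term_exp c g) (triple_term_summable htau h0 (- c) c g).
Qed.

Lemma balanced_exp c g :
  Sum (T (- c) c g) = Sum (fun N : int => q (c * N%:~R) * diff_coef tau h g `|N|%N).
Proof.
rewrite (eq_Sum (triple_term_exp c g)).
apply: (balanced_sum htau h0 (w := fun N => q (c * N%:~R))).
exact: eq_abs_summable (triple_term_exp c g) (triple_term_summable htau h0 (- c) c g).
Qed.

Lemma hexsum_rows a b : hexsum tau h a b = Sum (fun N : int =>
  q (a * N%:~R) * Sum (fun n : int => q (h * (N%:~R ^+ 2 + N%:~R * n%:~R + n%:~R ^+ 2) + b * n%:~R))).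
Proof.
have sh := hex_summable htau h0 a b.
rewrite /hexsum (Sum_prod sh); apply: eq_Sum => N /=.
rewrite -SumZ; last first.
  apply: (abs_summable_le (c := normc (q (a * N%:~R))^-1)) (abs_summable_prodP sh N) => n /=.
  rewrite -normcM -qpowN -qpowD le_eqVlt; apply/orP; left; apply/eqP.
  by congr (normc (q _)); ring.
by apply: eq_Sum => n; rewrite -qpowD; congr q; ring.
Qed.

Lemma sum_theta0 c : J ^+ 2 * Sum (T (- c) c 0) = hexsum tau h c 0.
Proof.
rewrite balanced_exp hexsum_rows -(SumZ _ (balanced_exp_summable c 0)).
apply: eq_Sum => N; rewrite mulrCA (diff_coef_theta0 htau h0).
by congr (_ * _); apply: eq_Sum => n; congr q; ring.
Qed.

Lemma sum_thetaN : J ^+ 2 * Sum (T 0 0 (- h)) = hexsum tau h 0 (- h) + hexsum tau h (- h) (- h).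
Proof.
have e := balanced_exp 0 (- h); rewrite oppr0 in e.
rewrite e -(SumZ _ (balanced_exp_summable 0 (- h))).
have s1 := abs_summable_Sum (hex_summable htau h0 0 (- h)).
have s2 := abs_summable_Sum (hex_summable htau h0 (- h) (- h)).
rewrite /hexsum (Sum_prod (hex_summable htau h0 0 (- h))) (Sum_prod (hex_summable htau h0 (- h) (- h))).
rewrite -(SumD s1 s2).
apply: eq_Sum => N /=; rewrite mulrCA (diff_coef_thetaN htau h0) mul0r qpow0 mul1r.
rewrite (mulrDl 1) mul1r; congr (_ + _).
  by apply: eq_Sum => n; congr q; ring.
rewrite -SumZ; last first.
  apply: eq_abs_summable (abs_summable_prodP (hex_summable htau h0 0 (- h)) N) => n.
  by congr q; ring.
by apply: eq_Sum => n; rewrite -qpowD; congr q; ring.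
Qed.

(** The coefficient of N is even in N, and the weights of N and -N add up to
    q^(-hN/2) (1 + q^(hN)), whose second factor cancels the denominator of the
    coefficient. *)
Lemma sum_thetaP : 2 * (J ^+ 2 * Sum (T (h / 2) (- (h / 2)) h)) = hexsum tau h (- (h / 2)) (- h).
Proof.
have s1 := balanced_exp_summable (- (h / 2)) h.
have e := balanced_exp (- (h / 2)) h; rewrite opprK in e.
have NK : cancel (fun N : int => - N) (fun N => - N) by move=> N; rewrite opprK.
have s2 := abs_summable_inj (can_inj NK) s1.
have -> : 2 * (J ^+ 2 * Sum (T (h / 2) (- (h / 2)) h)) =
   J ^+ 2 * (Sum (T (h / 2) (- (h / 2)) h) + Sum (T (h / 2) (- (h / 2)) h)).
  by move: (Sum _) J => x y; ring.
rewrite e {2}(Sum_bij NK NK s1) -(SumD s1 s2) -(SumZ _ (abs_summableD s1 s2)) hexsum_rows.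
apply: eq_Sum => N; rewrite /comp abszN -mulrDl mulrCA.
have -> : q (- (h / 2) * N%:~R) + q (- (h / 2) * (- N)%:~R) =
   q (- (h / 2) * N%:~R) * (1 + q (h * N%:~R)).
  rewrite mulrDr mulr1 -qpowD; congr (_ + q _); rewrite mulrNz; by field.
rewrite -mulrA (diff_coef_thetaP htau h0); congr (_ * _).
by apply: eq_Sum => n; congr q; ring.
Qed.

(** [Sum_shift] in the first of three indices. *)
Lemma shift_first (g : nat * nat * nat -> C) :
  abs_summable (fun t => (1 - Q ^+ t.1.1) * (g t / (P t.1.1 * P t.1.2 * P t.2))) ->
  Sum (fun t => (1 - Q ^+ t.1.1) * (g t / (P t.1.1 * P t.1.2 * P t.2))) =
  Sum (fun t => g (t.1.1.+1, t.1.2, t.2) / (P t.1.1 * P t.1.2 * P t.2)).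
Proof.
move=> s; rewrite (@Sum_inj _ _ _ (fun t : nat * nat * nat => (t.1.1.+1, t.1.2, t.2)) _ _ _ s); first last.
- move=> [[[|i] j] k] /=; first by rewrite expr0 subrr mul0r eqxx.
  by exists (i, j, k).
- by move=> [[i j] k] [[i' j'] k'] /= [-> -> ->].
apply: eq_Sum => -[[i j] k] /=; rewrite qpochQS.
have := one_subQX_neq0 htau h0 i; have := qpochQ_neq0 htau h0 i.
have := qpochQ_neq0 htau h0 j; have := qpochQ_neq0 htau h0 k.
move: (P i) (P j) (P k) (Q ^+ i.+1) (g _) => x y z u v nz ny nx nu.
by field; rewrite nz ny nx nu.
Qed.

Definition triple_exp (a b g : rat) (t : nat * nat * nat) : rat :=
  h * (t.1.1%:R ^+ 2 + t.1.2%:R ^+ 2 + t.2%:R ^+ 2 - t.1.1%:R * t.2%:R - t.1.2%:R * t.2%:R)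
     + a * t.1.1%:R + b * t.1.2%:R + g * t.2%:R.

Lemma triple_exp_shift g i j k : triple_exp (- h) h g (i.+1, j, k) = triple_exp h h (g - h) (i, j, k).
Proof. by rewrite /triple_exp /= -natr1; ring. Qed.

Lemma triple_term_split g t :
  T (- h) h g t - T h h g t =
  (1 - Q ^+ t.1.1) * (q (triple_exp (- h) h g t) / (P t.1.1 * P t.1.2 * P t.2)).
Proof.
rewrite mulrA (mulrDl 1) mul1r !mulNr qpowX -qpowD mulrDl mulNr.
by congr (q _ / _ - q _ / _); rewrite /triple_exp; ring.
Qed.

(** The relation S(x/Q, y, z) = S(x, y, z) + (x/q^h) S(x, y, z/q^h) between the
    generating functions, from q^(-hi) = q^(hi) + q^(-hi) (1 - Q^i). *)
Lemma sum_contiguous g : Sum (T (- h) h g) = Sum (T h h g) + Sum (T h h (g - h)).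
Proof.
have s1 := triple_term_summable htau h0 (- h) h g; have s2 := triple_term_summable htau h0 h h g.
apply/eqP; rewrite addrC -subr_eq -(SumB s1 s2) (eq_Sum (triple_term_split g)); apply/eqP.
rewrite shift_first; last exact: eq_abs_summable (triple_term_split g) (abs_summableB s1 s2).
by apply: eq_Sum => -[[i j] k]; rewrite triple_exp_shift.
Qed.

Local Notation W t := ((t.1.2%:Z - t.1.1%:Z)%:~R : C).

(** Exchanging i and j fixes the term and negates the weight j - i. *)
Lemma weighted_antisym g : Sum (fun t => W t * T h h g t) = 0.
Proof.
have s := triple_term_summable_weight htau h0 h h g.
have sK : cancel (fun t : nat * nat * nat => (t.1.2, t.1.1, t.2)) (fun t => (t.1.2, t.1.1, t.2)) by move=> [[i j] k].
suff H : Sum (fun t => W t * T h h g t) = - Sum (fun t => W t * T h h g t).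
  move: H; move: (Sum _) => x /eqP.
  by rewrite -subr_eq0 opprK -mulr2n mulrn_eq0 => /eqP.
rewrite {1}(Sum_bij sK sK s) -mulN1r -(SumZ _ s); apply: eq_Sum => -[[i j] k] /=.
rewrite mulN1r -mulNr -mulrNz opprB; congr (_ * _); rewrite /triple_term /=.
by rewrite (mulrC (P j)); congr (q _ / _); ring.
Qed.

(** The contiguous relation with the weight j - i.  The shift i |-> i + 1 lowers the
    weight by one, and only this correction survives [weighted_antisym]; the
    effect is that of differentiating the relation in the parameter attached to
    j - i. *)
Lemma weighted_contiguous g :
  Sum (fun t => W t * T (- h) h g t) = - Sum (T h h (g - h)).
Proof.
have s1 := triple_term_summable_weight htau h0 (- h) h g.
have s2 := triple_term_summable_weight htau h0 h h g.
have s3 := triple_term_summable htau h0 h h (g - h).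
have s4 := triple_term_summable_weight htau h0 h h (g - h).
rewrite -[LHS]subr0 -(weighted_antisym g) -(SumB s1 s2).
have e t : W t * T (- h) h g t - W t * T h h g t =
  (1 - Q ^+ t.1.1) * ((W t * q (triple_exp (- h) h g t)) / (P t.1.1 * P t.1.2 * P t.2)).
  by rewrite -mulrBr triple_term_split mulrCA (mulrA (W t)).
rewrite (eq_Sum e) (shift_first (g := fun t => W t * q (triple_exp (- h) h g t))); last first.
  exact: eq_abs_summable e (abs_summableB s1 s2).
rewrite -[RHS]add0r -(weighted_antisym (g - h)) -(SumB s4 s3).
apply: eq_Sum => -[[i j] k]; rewrite triple_exp_shift /=.
rewrite (_ : j%:Z - i.+1%:Z = (j%:Z - i%:Z) - 1); last lia.
by rewrite rmorphB rmorph1 mulrBl mul1r mulrBl -mulrA.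
Qed.

Lemma weighted_theta :
  J ^+ 2 * Sum (fun t => W t * T (- h) h 0 t) =
  Sum (fun x : int * int => x.1%:~R *
    q (h * (x.1%:~R ^+ 2 + x.1%:~R * x.2%:~R + x.2%:~R ^+ 2) + h * x.1%:~R + 0 * x.2%:~R)).
Proof.
have s := triple_term_summable_weight htau h0 (- h) h 0.
have e t : W t * T (- h) h 0 t =
    (fun N : int => N%:~R * q (h * N%:~R)) (t.1.2%:Z - t.1.1%:Z) * T 0 0 0 t.
  by rewrite triple_term_exp /= mulrA.
have s' := eq_abs_summable e s.
have sh := hex_summable_weight htau h0 h 0.
pose w (N : int) : C := N%:~R * q (h * N%:~R).
apply: etrans (congr1 _ (etrans (eq_Sum e) (balanced_sum htau h0 (w := w) s'))) _.
rewrite (Sum_prod sh) -(SumZ _ (balanced_summable htau h0 (w := w) s')).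
apply: eq_Sum => N; rewrite /w /=.
rewrite mulrCA (diff_coef_theta0 htau h0) -mulrA -SumZ; last first.
  apply: eq_abs_summable (abs_summableZ (q (- h * N%:~R)) (abs_summable_prodP (hex_summable htau h0 h 0) N)) => n /=.
  by rewrite -qpowD; congr q; ring.
rewrite -SumZ; last first.
  apply: eq_abs_summable (abs_summable_prodP (hex_summable htau h0 h 0) N) => n /=.
  by rewrite -qpowD; congr q; ring.
by apply: eq_Sum => n; rewrite -qpowD; congr (_ * q _); ring.
Qed.

End TripleSums.

Opaque hexsum.

(** * The triple sum that is an infinite product *)

Section ProductCase.
Variables (R : realType) (tau : R[i]) (h : rat).
Hypothesis htau : 0 < complex.Im tau.
Hypothesis h0 : 0 < h.
Local Notation C := R[i].
Local Notation q := (qpow tau).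
Local Notation Q := (qpow tau (2 * h)).
Local Notation P := (qpoch Q Q).
Local Notation T := (triple_term tau h).

(** Each factor 1 + q^(-hl), for 1 <= l <= k, is q^(-hl) (1 + q^(hl)). *)
Lemma qpoch_negative k : qpoch (- q (- (h * k%:R))) (q h) k =
  q (- (h / 2 * k%:R ^+ 2 + h / 2 * k%:R)) * qpoch (- q h) (q h) k.
Proof.
elim: k => [|k IH].
  by rewrite !qpoch0 mulr1 (_ : - _ = 0) ?qpow0 //; ring.
rewrite qpochSl (mulNr (q _)) -qpowD.
have -> : - (h * k.+1%:R) + h = - (h * k%:R) by rewrite -natr1; ring.
rewrite IH qpochS qpowX !opprK (mulNr (q h)) opprK -qpowD.
have -> : h + k%:R * h = h * k.+1%:R by rewrite -natr1; ring.
have -> : - (h / 2 * k.+1%:R ^+ 2 + h / 2 * k.+1%:R) =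
  - (h * k.+1%:R) - (h / 2 * k%:R ^+ 2 + h / 2 * k%:R) by rewrite -natr1; field.
have e : q (- (h * k.+1%:R)) * q (h * k.+1%:R) = 1 by rewrite -qpowD addNr qpow0.
rewrite (qpowD _ (- (h * k.+1%:R))).
move: (qpoch _ _ _) (q (- (h / 2 * _ + _))) => u z; move: e.
move: (q (- (h * _))) (q (h * _)) => x y e.
by rewrite -[X in (X + x) * _]e; ring.
Qed.

(** The two products interlace into (-q^(-hk); q^h)_oo, whose first k factors
    cancel half of (Q;Q)_k = (q^h;q^h)_k (-q^h;q^h)_k. *)
Lemma product_row k :
  qpoch_inf (- q (h + - (h * k%:R))) Q * qpoch_inf (- q (h + (- h - h * k%:R))) Q / P k =
  qpoch_inf (- 1) (q h) * (q (- (h / 2 * k%:R ^+ 2 + h / 2 * k%:R)) / qpoch (q h) (q h) k).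
Proof.
have := @qpoch_inf_multisection _ _ htau 2 h (- q (- (h * k%:R))) isT h0.
rewrite -(big_mkord xpredT (fun r => qpoch_inf (- q (- (h * k%:R)) * q (r%:R * h)) (q (2%:R * h)))).
do 2 (rewrite big_ltn; last by []); rewrite big_geq; last by [].
rewrite !(mulNr (q _)) -!qpowD.
have -> : - (h * k%:R) + 0%:R * h = h + (- h - h * k%:R) by ring.
have -> : - (h * k%:R) + 1%:R * h = h + - (h * k%:R) by ring.
have := qpochQ_neq0 htau h0 k; have := qpoch_sq (q h) (q h) k; rewrite qpowX => <-.
rewrite mulf_eq0 negb_or => /andP[nz1 nz2].
have h2 : 0 < h / 2 by rewrite divr_gt0.
have := @qpoch_inf_shift _ _ _ htau h2 (- q (- (h * k%:R))) k.
rewrite (_ : 2 * (h / 2) = h); last by field.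
rewrite qpoch_negative qpowX (mulNr (q _)) -qpowD (_ : - (h * k%:R) + k%:R * h = 0); last by ring.
rewrite qpow0 => ->.
move: nz1 nz2; move: (qpoch (q h) _ _) (qpoch (- q h) _ _) (qpoch_inf (- 1) _) => x y z nx ny.
move: (qpoch_inf _ _) (qpoch_inf _ _) (q _) => u v w; rewrite mulr1 => e.
by rewrite mulrC [X in _ * X = _]mulrC -e; field; rewrite nx ny.
Qed.

(** Euler's expansion in i and in j, then, after [product_row], in k with base
    q^h. *)
Lemma sum_product c : Sum (T 0 (- h) c) = qpoch_inf (- 1) (q h) * qpoch_inf (- q c) (q h).
Proof.
have s := triple_term_summable htau h0 0 (- h) c.
have h2 : 0 < h / 2 by rewrite divr_gt0.
rewrite (Sum_prod s) (Sum_swap s).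
have eh : 2 * (h / 2) = h by field.
have s2 := eulerq_summable htau h2 (c - h / 2); rewrite eh in s2.
have e2 := eulerE htau h2 (c - h / 2); rewrite eh (_ : h / 2 + (c - h / 2) = c) in e2; last by ring.
rewrite -e2 -(SumZ _ s2); apply: eq_Sum => k.
have e (x : nat * nat) : T 0 (- h) c (x, k) =
   q (h * k%:R ^+ 2 + c * k%:R) / P k *
   ((q (h * x.1%:R ^+ 2 + - (h * k%:R) * x.1%:R) / P x.1) *
    (q (h * x.2%:R ^+ 2 + (- h - h * k%:R) * x.2%:R) / P x.2)).
  rewrite /triple_term /= !mulf_div -!qpowD (mulrC (P k)); congr (q _ / _); ring.
rewrite (eq_Sum e) SumZ; last exact: euler_mul_summable.
rewrite euler_mul // mulrAC -mulrA product_row mulrCA; congr (_ * _).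
by rewrite mulrA -qpowD; congr (q _ / _); field.
Qed.

End ProductCase.

(** * The six identities *)

Section Elimination.
Variable F : numFieldType.
Implicit Types x y z t u : F.

Lemma solve_cubic y j1 j3 : j1 != 0 -> j1 * y = 3 * j3 ^+ 3 -> y = 3 * (j3 ^+ 3 / j1) :> F.
Proof. by move=> n1 e; apply: (mulfI n1); rewrite e; field. Qed.

Lemma solve_sixfold x y j1 j2 j3 : j1 != 0 -> j2 != 0 -> j1 * y = 3 * j3 ^+ 3 ->
  j2 ^+ 2 * x = y + y -> x = 6 * (j3 ^+ 3 / (j1 * j2 ^+ 2)) :> F.
Proof.
move=> n1 n2 /(solve_cubic n1) -> e; apply: (mulfI (expf_neq0 2 n2)).
by rewrite e; field; rewrite n1 n2.
Qed.

Lemma solve_double x y j1 j2 j3 : j1 != 0 -> j2 != 0 -> j1 * y = 3 * j3 ^+ 3 ->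
  3 * (j2 ^+ 2 * - x) = - 2 * y -> x = 2 * (j3 ^+ 3 / (j1 * j2 ^+ 2)) :> F.
Proof.
move=> n1 n2 /(solve_cubic n1) -> e.
have n3 : (- 3 : F) != 0 by rewrite oppr_eq0 pnatr_eq0.
apply: (mulfI (mulf_neq0 n3 (expf_neq0 2 n2))).
have -> : - 3 * j2 ^+ 2 * x = 3 * (j2 ^+ 2 * - x) by ring.
by rewrite e; field; rewrite n1 n2.
Qed.

Lemma solve_simple x w y j1 j2 j3 : j1 != 0 -> j2 != 0 -> j1 * y = 3 * j3 ^+ 3 ->
  j2 ^+ 2 * (x + w) = y -> w = 2 * (j3 ^+ 3 / (j1 * j2 ^+ 2)) ->
  x = j3 ^+ 3 / (j1 * j2 ^+ 2) :> F.
Proof.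
move=> n1 n2 /(solve_cubic n1) -> e ew; rewrite -[LHS](addrK w).
have -> : x + w = 3 * (j3 ^+ 3 / j1) / j2 ^+ 2 by rewrite -e; field.
by rewrite ew; field; rewrite n1 n2.
Qed.

Lemma solve_psi x z t u j1 j2 j3 j4 j6 : j1 != 0 -> j3 != 0 -> j4 != 0 ->
  2 * (j4 ^+ 2 * x) = z -> 2 * z = t * u -> j1 * t = 2 * j2 ^+ 2 ->
  j3 * u = 2 * j6 ^+ 2 -> x = j2 ^+ 2 * j6 ^+ 2 / (j1 * j3 * j4 ^+ 2) :> F.
Proof.
move=> n1 n3 n4 <- e et eu.
have n2 : (2 : F) != 0 by rewrite pnatr_eq0.
have -> : j2 ^+ 2 * j6 ^+ 2 = j1 * j3 * j4 ^+ 2 * x; last by field; rewrite n1 n3 n4.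
apply: (mulfI n2); apply: (mulfI n2).
have -> : 2 * (2 * (j2 ^+ 2 * j6 ^+ 2)) = (2 * j2 ^+ 2) * (2 * j6 ^+ 2) by ring.
rewrite -et -eu (_ : _ * _ * _ = j1 * j3 * (t * u)); last by ring.
by rewrite -e; ring.
Qed.

Lemma solve_theta s x y z t u j : j != 0 -> j ^+ 2 * s = x * y + u * (z * t) ->
  s = x * y / j ^+ 2 + u * (z * t / j ^+ 2) :> F.
Proof. by move=> nj e; apply: (mulfI (expf_neq0 2 nj)); rewrite e; field. Qed.

End Elimination.

Section Conclusion.
Variables (R : realType) (tau : R[i]).
Hypothesis htau : 0 < complex.Im tau.
Local Notation q := (qpow tau).

Lemma has_sum3_triple (h a b c s : rat) (e : nat -> nat -> nat -> rat) l :
  0 < h -> s = 2 * h -> (forall i j k, e i j k = triple_exp h a b c (i, j, k)) ->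
  Sum (triple_term tau h a b c) = l ->
  has_sum3 (fun i j k : nat => q (e i j k) /
    (qpoch (q s) (q s) i * qpoch (q s) (q s) j * qpoch (q s) (q s) k)) l.
Proof.
move=> h0 -> E <-; rewrite /has_sum3.
rewrite (_ : (fun t => _) = triple_term tau h a b c); first exact/Sum_has_sum/triple_term_summable.
by apply/funext => -[[i j] k] /=; rewrite E.
Qed.

Lemma Jbar_theta h b c m : 0 < h -> m%:R = 2 * h -> b = h + c ->
  Jbar tau b m = theta tau h c.
Proof.
move=> h0 em ->; rewrite (@theta_product _ _ htau h c (h + c) (h - c) m%:R) //.
rewrite /Jbar /qpochs_inf !big_cons big_nil em.
rewrite (_ : 2 * h - (h + c) = h - c); last by ring.
by move: (qpoch_inf _ _) (qpoch_inf _ _) (qpoch_inf _ _) => *; ring.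
Qed.

Lemma J_neq0 m : (0 < m)%N -> J tau m != 0.
Proof. by move=> m0; apply: qpoch_inf_neq0 => //; rewrite ltr0n. Qed.

End Conclusion.

Theorem theorem6p3 (R : realType) (tau : R[i]) (a c : rat)
    (htau : 0 < complex.Im tau) :
  let q := qpow tau in
  [/\
      has_sum3 (fun i j k : nat =>
        q (2 * i%:R ^+ 2 + 2 * j%:R ^+ 2 + 2 * k%:R ^+ 2
           - 2 * i%:R * k%:R - 2 * j%:R * k%:R - 2 * j%:R + a * k%:R)
        / (qpoch (q 4) (q 4) i * qpoch (q 4) (q 4) j * qpoch (q 4) (q 4) k))
        (qpochs_inf [:: - 1; - q a] (q 2)),
      has_sum3 (fun i j k : nat =>
        q (2 * i%:R ^+ 2 + 2 * j%:R ^+ 2 + 2 * k%:R ^+ 2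
           - 2 * i%:R * k%:R - 2 * j%:R * k%:R + i%:R - j%:R + 2 * k%:R)
        / (qpoch (q 4) (q 4) i * qpoch (q 4) (q 4) j * qpoch (q 4) (q 4) k))
        (J tau 2 ^+ 2 * J tau 6 ^+ 2 / (J tau 1 * J tau 3 * J tau 4 ^+ 2)),
      has_sum3 (fun i j k : nat =>
        q (2 * i%:R ^+ 2 + 2 * j%:R ^+ 2 + 2 * k%:R ^+ 2
           - 2 * i%:R * k%:R - 2 * j%:R * k%:R - c * i%:R + c * j%:R)
        / (qpoch (q 4) (q 4) i * qpoch (q 4) (q 4) j * qpoch (q 4) (q 4) k))
        (Jbar tau (2 + c) 4 * Jbar tau (6 + c) 12 / J tau 4 ^+ 2
         + q 2 * (Jbar tau (- c) 4 * Jbar tau c 12 / J tau 4 ^+ 2))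
    & [/\
      has_sum3 (fun i j k : nat =>
        q (i%:R ^+ 2 + j%:R ^+ 2 + k%:R ^+ 2
           - i%:R * k%:R - j%:R * k%:R - k%:R)
        / (qpoch (q 2) (q 2) i * qpoch (q 2) (q 2) j * qpoch (q 2) (q 2) k))
        (6 * (J tau 3 ^+ 3 / (J tau 1 * J tau 2 ^+ 2))),
      has_sum3 (fun i j k : nat =>
        q (i%:R ^+ 2 + j%:R ^+ 2 + k%:R ^+ 2
           - i%:R * k%:R - j%:R * k%:R + i%:R + j%:R - k%:R)
        / (qpoch (q 2) (q 2) i * qpoch (q 2) (q 2) j * qpoch (q 2) (q 2) k))
        (2 * (J tau 3 ^+ 3 / (J tau 1 * J tau 2 ^+ 2)))
    & has_sum3 (fun i j k : nat =>
        q (i%:R ^+ 2 + j%:R ^+ 2 + k%:R ^+ 2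
           - i%:R * k%:R - j%:R * k%:R + i%:R + j%:R)
        / (qpoch (q 2) (q 2) i * qpoch (q 2) (q 2) j * qpoch (q 2) (q 2) k))
        (J tau 3 ^+ 3 / (J tau 1 * J tau 2 ^+ 2))]].
Proof.
have h1 : (0 : rat) < 1 := ltr01.
have h2 : (0 : rat) < 2 by [].
have J1 : J tau 1 != 0 by exact: J_neq0.
have J2 : J tau 2 != 0 by exact: J_neq0.
have J3 : J tau 3 != 0 by exact: J_neq0.
have J4 : J tau 4 != 0 by exact: J_neq0.
have cubic : J tau 1 * hexsum tau 1 1 0 = 3 * J tau 3 ^+ 3 := hexsum_cubic htau.
have c2 : J tau 2 ^+ 2 * Sum (triple_term tau 1 (- 1) 1 0) = hexsum tau 1 1 0 :=
  sum_theta0 htau h1 1.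
have V4 : Sum (triple_term tau 1 0 0 (- 1)) = 6 * (J tau 3 ^+ 3 / (J tau 1 * J tau 2 ^+ 2)).
  apply: solve_sixfold J1 J2 cubic _.
  have e1 : J tau 2 ^+ 2 * _ = _ := sum_thetaN htau h1.
  have e2 := congr2 +%R (hexsum_swap htau) (hexsum_rot htau).
  exact (etrans e1 e2).
(* The fifth sum is minus the weighted one, which is -2/3 of the cubic theta
   function; the sixth is what it lacks to the balanced sum [c2]. *)
have V5 : Sum (triple_term tau 1 1 1 (- 1)) = 2 * (J tau 3 ^+ 3 / (J tau 1 * J tau 2 ^+ 2)).
  apply: solve_double J1 J2 cubic _.
  have e1 := weighted_contiguous htau h1 0; rewrite (sub0r 1) in e1.
  have e2 : J tau 2 ^+ 2 * _ = _ := weighted_theta htau h1.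
  by rewrite -e1 e2; exact: hexsum_center htau.
have V6 : Sum (triple_term tau 1 1 1 0) = J tau 3 ^+ 3 / (J tau 1 * J tau 2 ^+ 2).
  apply: solve_simple J1 J2 cubic _ V5; rewrite -c2.
  by have := sum_contiguous htau h1 0; rewrite (sub0r 1) => ->.
have V3 : Sum (triple_term tau 2 (- c) c 0) = Jbar tau (2 + c) 4 * Jbar tau (6 + c) 12 / J tau 4 ^+ 2
         + qpow tau 2 * (Jbar tau (- c) 4 * Jbar tau c 12 / J tau 4 ^+ 2).
  have e1 := sum_theta0 htau h2 c.
  rewrite (_ : qpoch_inf _ _ = J tau 4) // hexsum_parity // in e1.
  rewrite (@Jbar_theta _ _ htau 2 (2 + c) c 4) // (@Jbar_theta _ _ htau 6 (6 + c) c 12) //.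
  rewrite (@Jbar_theta _ _ htau 2 (- c) (- 2 - c) 4) //; last by ring.
  rewrite (@Jbar_theta _ _ htau 6 c (c - 6) 12) //; last by ring.
  exact (solve_theta J4 e1).
have V2 : Sum (triple_term tau 2 1 (- 1) 2) =
    J tau 2 ^+ 2 * J tau 6 ^+ 2 / (J tau 1 * J tau 3 * J tau 4 ^+ 2).
  have e1 : 2 * (J tau 4 ^+ 2 * _) = _ := sum_thetaP htau h2.
  have e2 := hexsum_psi htau.
  have psi (k : rat) m n : 0 < k -> n%:R = 2 * k -> m%:R = 4 * k ->
      J tau n * theta tau k k = 2 * J tau m ^+ 2.
    by move=> k0 en em; rewrite /J en em; exact: psi_sum.
  apply: solve_psi J1 J3 J4 e1 e2 _ _; exact: psi.
split; last split.
- apply: (@has_sum3_triple _ _ htau 2 0 (- 2) a) => //.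
    by move=> i j k; rewrite /triple_exp /=; ring.
  by rewrite sum_product // /qpochs_inf !big_cons big_nil mulr1.
- apply: has_sum3_triple V2 => // i j k; rewrite /triple_exp /=; ring.
- apply: has_sum3_triple V3 => // i j k; rewrite /triple_exp /=; ring.
- apply: has_sum3_triple V4 => // i j k; rewrite /triple_exp /=; ring.
- apply: has_sum3_triple V5 => // i j k; rewrite /triple_exp /=; ring.
- apply: has_sum3_triple V6 => // i j k; rewrite /triple_exp /=; ring.
Qed.
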